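(* (i) Let $1\le p<\infty$. There exists a constant $C$ depending only on $p$ such that for every probability measure $\nu$ on $[0,\infty)$ and every $0<\varepsilon<1/4$, $$\log N_{[\,]}(\varepsilon,\mathcal{M}_\infty,\|\cdot\|_{L^p(\nu)})\le C\log(\Gamma/\gamma)\cdot|\log\varepsilon|^2$$ for any $0<\gamma<\Gamma<\infty$ such that $\nu([\gamma,\Gamma])\ge 1-4^{-p}\varepsilon^p$. In particular, if there exists a constant $K>1$ such that $\nu([\varepsilon^K,\varepsilon^{-K}])\ge 1-4^{-p}\varepsilon^p$, then $$\log N_{[\,]}(\varepsilon,\mathcal{M}_\infty,\|\cdot\|_{L^p(\nu)})\le CK|\log\varepsilon|^3.$$ (ii) If $\nu$ is Lebesgue measure on $[0,1]$, then, for $0<\varepsilon<1/4$, $$\log N_{[\,]}(\varepsilon,\mathcal{M}_\infty,\|\cdot\|_{L^2(\nu)})\asymp \log N(\varepsilon,\mathcal{M}_\infty,\|\cdot\|_{L^2(\nu)})\asymp|\log\varepsilon|^3.$$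
   Context: $\mathcal{M}_\infty$ is the class of completely monotone functions on $[0,\infty)$ that are bounded by $1$, that is, the class of all functions $f:[0,\infty)\to[0,\infty)$ of the form $f(t)=\int_0^\infty e^{-tx}\,\mu(dx)$, where $\mu$ is a (non-negative) measure on $[0,\infty)$ with total mass $\|\mu\|\le 1$. For a probability measure $\nu$ on $[0,\infty)$ and $1\le p<\infty$, $\|f\|_{L^p(\nu)}^p=\int_0^\infty|f(x)|^p\,\nu(dx)$. For a function class $\mathcal{F}$ and a distance $\rho$, $N(\varepsilon,\mathcal{F},\rho)$ is the minimum number of open balls of radius $\varepsilon$ needed to cover $\mathcal{F}$. The bracketing number is $$N_{[\,]}(\varepsilon,\mathcal{F},\rho)=\min\Big\{n:\ \exists\,\underline{f}_1,\overline{f}_1,\dots,\underline{f}_n,\overline{f}_n\ \text{such that}\ \rho(\overline{f}_k,\underline{f}_k)\le\varepsilon\ \text{for all } k,\ \mathcal{F}\subset\bigcup_{k=1}^n[\underline{f}_k,\overline{f}_k]\Big\},$$ where $[\underline{f}_k,\overline{f}_k]=\{g\in\mathcal{F}:\underline{f}_k\le g\le\overline{f}_k\}$. When $\rho$ is given as a norm, the distance induced by that norm is meant. $A\asymp B$ means that there exist universal constants $C_1,C_2>0$ (not depending on $\varepsilon$) such that $C_1A\le B\le C_2A$.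
   Formalization: In the first inequality of (i), log(Γ/γ) is replaced by max(1, log(Γ/γ)), since the bound as stated fails when Γ/γ is close to 1 (e.g. ν a point mass at 1, with γ and Γ both tending to 1). *)

(* Defs.v *)
From HB Require Import structures.
From mathcomp Require Import all_boot all_order all_algebra.
From mathcomp Require Import all_classical all_reals all_analysis.
Set Implicit Arguments.
Unset Strict Implicit.
Unset Printing Implicit Defensive.
Import Order.TTheory GRing.Theory Num.Theory.
Import numFieldNormedType.Exports.
Local Open Scope classical_set_scope.
Local Open Scope ring_scope.

(* A measure on [0, +oo[ is encoded as a Borel measure on the real line
   concentrated on [0, +oo[, and a function on [0, +oo[ as its extension by 0
   to the real line. *)
Definition on_nonneg (R : realType)
    (mu : {measure set (measurableTypeR R) -> \bar R}) : Prop :=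
  mu `]-oo, 0%R[%classic = 0%E.

Definition M_infty (R : realType) : set (measurableTypeR R -> R) :=
  [set f | (forall t : R, t < 0 -> f t = 0) /\
    exists mu : {measure set (measurableTypeR R) -> \bar R},
      [/\ on_nonneg mu, (mu setT <= 1)%E &
          forall t : R, 0 <= t ->
            (f t)%:E = (\int[mu]_(x in `[0%R, +oo[) (expR (- (t * x)))%:E)%E]].

Section entropy_numbers.
Context (T : Type) (R : realType).
(* [E] is the ambient space of functions on which the distance [rho] lives:
   it contains the centers of the balls and the ends of the brackets. *)
Variables (E : set (T -> R)) (rho : (T -> R) -> (T -> R) -> \bar R).

(* The infimum over an empty set of cardinalities is +oo; otherwise, it is a
   minimum. *)
Definition covering_number (eps : R) (F : set (T -> R)) : \bar R :=
  ereal_inf [set n%:R%:E | n in [set n : nat |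
    exists c : 'I_n -> T -> R,
      (forall k, E (c k)) /\
      F `<=` \bigcup_k [set g | (rho g (c k) < eps%:E)%E]]].

Definition bracket (F : set (T -> R)) (l u : T -> R) : set (T -> R) :=
  [set g | F g /\ forall t, l t <= g t <= u t].

Definition bracketing_number (eps : R) (F : set (T -> R)) : \bar R :=
  ereal_inf [set n%:R%:E | n in [set n : nat |
    exists l u : 'I_n -> T -> R,
      (forall k, [/\ E (l k), E (u k) & (rho (u k) (l k) <= eps%:E)%E]) /\
      F `<=` \bigcup_k bracket F (l k) (u k)]].

End entropy_numbers.

Section Lp_entropy.
Context (d : measure_display) (T : measurableType d) (R : realType).
Variables (nu : {measure set T -> \bar R}) (p : R).

Definition Lp_space : set (T -> R) := [set` Lfun nu p%:E].

Definition Lp_dist (f g : T -> R) : \bar R :=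
  ('N[nu]_p%:E [EFin \o (f \- g)%R])%E.

Definition Lp_covering_number := covering_number Lp_space Lp_dist.

Definition Lp_bracketing_number := bracketing_number Lp_space Lp_dist.

End Lp_entropy.

Definition lebesgue01 (R : realType) :
    {measure set (measurableTypeR R) -> \bar R} :=
  mrestr (@lebesgue_measure R)
    (measurable_itv `[0, 1] : measurable (`[0, 1]%classic : set (measurableTypeR R))).

Definition asymp_on (R : realType) (D : set R) (A B : R -> \bar R) : Prop :=
  exists C1 C2 : R, [/\ 0 < C1, 0 < C2 &
    forall eps, D eps ->
      (C1%:E * A eps <= B eps)%E /\ (B eps <= C2%:E * A eps)%E].

(* Main.v *)
(* Upper bound.  On a dyadic interval ]b/2, b] a function of the class is a power
   series in s = 1 - t/b, with coefficients c_k in [0, 1] of sum at most 1; hence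
   truncating it at rank n costs at most 2^-n.  Rounding the O(|ln eps|) first
   coefficients to a grid of mesh O(eps) gives exp(O(|ln eps|^2)) brackets per
   interval, and O(ln (Gamma / gamma)) intervals cover [gamma, Gamma].  Outside,
   the bracket [0, 1] is good enough.

   Lower bound.  Take the sums of w_i exp(- x_i t) over s^2 nodes x_i, made of s
   clusters of s points, with weights w_i on a grid of 2^s values: there are
   2^(s^3) of them.  The squared norm of such a sum with coefficients a_i in
   L^2(0, +oo) is the Cauchy form Q(a) = sum a_i a_j / (x_i + x_j).  Multiplying
   each a_i by (x_i - y) / (x_i + y), a Blaschke factor, does not increase Q, so
   that killing all the coefficients but a_k yields
     Q(a) >= a_k^2 / (2 x_k) * prod_(i != k) ((x_k - x_i) / (x_k + x_i))^2.
   For these nodes the product is at least 2^(- O(s)), and the nodes are large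
   enough for the contribution of ]1, +oo[ to be negligible; hence the sums are
   2^(- O(s))-separated in L^2(0, 1). *)
Require Import Defs.
From mathcomp Require Import all_boot all_order all_algebra.
From mathcomp Require Import all_classical all_reals all_analysis.
From mathcomp Require Import measurable_realfun ring lra zify.
Import Order.TTheory GRing.Theory Num.Theory.
Import numFieldNormedType.Exports.
Local Open Scope classical_set_scope.
Local Open Scope ring_scope.

(** * Cauchy forms and Blaschke factors *)

Definition cauchy_form {R : fieldType} {I : finType} (x a : I -> R) : R :=
  \sum_i \sum_j a i * a j / (x i + x j).

(** Since [(u + y) * (v + y) - (u - y) * (v - y) = 2 * y * (u + v)], the denominators [x i + x j]
    cancel in the difference of the two forms, which is therefore a square times [2 * y]. *)
Lemma cauchy_form_contraction (R : realFieldType) (I : finType) (x a : I -> R)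
    (y : R) : 0 < y -> (forall i, 0 < x i) ->
  cauchy_form x (fun i => a i * ((x i - y) / (x i + y))) <= cauchy_form x a.
Proof.
move=> y0 x0; rewrite -subr_ge0.
suff -> : cauchy_form x a - cauchy_form x (fun i => a i * ((x i - y) / (x i + y)))
    = 2 * y * (\sum_i a i / (x i + y)) ^+ 2.
  by rewrite mulr_ge0 ?sqr_ge0 ?mulr_ge0 ?ltW.
rewrite /cauchy_form -sumrB expr2 big_distrlr /= mulr_sumr.
apply: eq_bigr => i _; rewrite -sumrB mulr_sumr; apply: eq_bigr => j _.
have xij : x i + x j != 0 by rewrite gt_eqF ?addr_gt0.
have xi : x i + y != 0 by rewrite gt_eqF ?addr_gt0.
have xj : x j + y != 0 by rewrite gt_eqF ?addr_gt0.
by field; rewrite xij xi xj.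
Qed.

Lemma cauchy_form_ge (R : realFieldType) (I : finType) (x a : I -> R) (k : I) :
    (forall i, 0 < x i) ->
  a k ^+ 2 / (2 * x k) * (\prod_(i | i != k) ((x k - x i) / (x k + x i))) ^+ 2
    <= cauchy_form x a.
Proof.
move=> x0.
have iter (r : seq I) :
    cauchy_form x (fun i => a i * \prod_(l <- r) ((x i - x l) / (x i + x l)))
      <= cauchy_form x a.
  elim: r => [|l r IHr].
    by under [X in cauchy_form _ X]funext do rewrite big_nil mulr1.
  apply: le_trans IHr; under [X in cauchy_form _ X]funext do
    rewrite big_cons [X in a _ * X]mulrC mulrA.
  exact: cauchy_form_contraction.
(* Taking as [y] every node except [x k] puts a zero factor in each coefficient of index [i != k];
   only the diagonal term at [k] survives. *)
apply: le_trans (iter [seq l <- index_enum I | l != k]).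
rewrite /cauchy_form [leRHS](bigD1 k)//= [X in _ <= _ + X]big1 => [|i ik]; last first.
  apply: big1 => j _.
  suff -> : \prod_(l <- [seq l <- index_enum I | l != k])
      ((x i - x l) / (x i + x l)) = 0 by rewrite mulr0 !mul0r.
  by rewrite big_filter (bigD1 i)//= subrr !mul0r.
rewrite addr0 [leRHS](bigD1 k)//= [X in _ <= _ + X]big1 => [|i ik]; last first.
  suff -> : \prod_(l <- [seq l <- index_enum I | l != k])
      ((x i - x l) / (x i + x l)) = 0 by rewrite !(mulr0, mul0r).
  by rewrite big_filter (bigD1 i)//= subrr !mul0r.
rewrite addr0 big_filter -mulr2n -[x k *+ 2]mulr_natl le_eqVlt; apply/orP; left.
by apply/eqP; set P := \prod_(_ | _) _; rewrite expr2 expr2; ring.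
Qed.

(** * Elementary bounds on products and factorials *)

(** With truncated subtraction, [(j - k) + (k - j)] is the distance between [j] and [k]. The indices
    on the left of [k] realise the distances 1 to [k], those on the right 1 to [s - 1 - k]. *)
Lemma prod_distn (R : comPzRingType) (F : nat -> R) (s : nat) (k : 'I_s) :
  \prod_(j < s | j != k) F ((j - k) + (k - j))%N =
  (\prod_(1 <= d < k.+1) F d) * \prod_(1 <= d < s - k) F d.
Proof.
rewrite (eq_bigl (fun j : 'I_s => (j : nat) != k)) //.
rewrite -(big_mkord (fun j => j != k) (fun j => F ((j - k) + (k - j))%N)).
rewrite (big_cat_nat (n := k)) //=; last exact: ltnW.
rewrite [X in _ * X]big_ltn_cond // eqxx /=.
congr (_ * _).
  rewrite big_add1 /= big_nat_rev /= add0n.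
  rewrite [LHS]big_nat_cond [RHS]big_nat_cond; apply: eq_big => [j|j /andP[jk _]].
    by case: ltnP => //= jk; apply/negP => /eqP; lia.
  by congr F; lia.
rewrite -{1}[k.+1]add0n big_addn -[in RHS](addn0 1%N) addnC.
rewrite -[X in \prod_(_ <= _ < X) _]/(s - k)%N [RHS]big_add1.
rewrite -subnS [LHS]big_nat_cond [RHS]big_nat_cond.
apply: eq_big => [j|j /andP[jk _]].
  by case: ltnP => //= jk; apply/negP => /eqP; lia.
by congr F; lia.
Qed.

Lemma leq_bin_expn2 (m k : nat) : ('C(m, k) <= 2 ^ m)%N.
Proof.
rewrite (_ : 2 ^ m = (1 + 1) ^ m)%N // expnDn.
have [km|mk] := leqP k m; last by rewrite bin_small.
by rewrite (bigD1 (Ordinal (km : k < m.+1)%N))//= !exp1n !muln1 leq_addr.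
Qed.

(** Each factor of the falling factorial [(2n) ^_ n] exceeds [n], and this factorial is
    ['C(2n, n) * n!], with a binomial coefficient at most [4 ^ n]. *)
Lemma leq_expnn_fact (n : nat) : (n ^ n <= 4 ^ n * n`!)%N.
Proof.
have ffact_ge k : (n ^ k <= (n + k) ^_ k)%N.
  elim: k => [|k IHk]; first by rewrite ffactn0.
  by rewrite expnS addnS ffactSS leq_mul // -?addnS leq_addr.
apply: leq_trans (ffact_ge n) _; rewrite -bin_ffact leq_mul2r.
by apply/orP; right; apply: leq_trans (leq_bin_expn2 _ _) _; rewrite addnn -mul2n expnM.
Qed.

Lemma prod_oneB_exprV4_ge (R : realFieldType) (n : nat) :
  3^-1 <= \prod_(1 <= d < n) (1 - 2 / 4 ^+ d) :> R.
Proof.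
case: n => [|n]; first by rewrite big_geq//; lra.
(* The bare bound 1/3 does not pass through the induction; the extra term, which tends to 0, makes
   it do so. *)
suff : 3^-1 + 2 / 3 * (4 ^+ n)^-1 <= \prod_(1 <= d < n.+1) (1 - 2 / 4 ^+ d) :> R.
  by apply: le_trans; rewrite lerDl mulr_ge0 ?invr_ge0 ?exprn_ge0.
elim: n => [|n IHn]; first by rewrite big_geq// expr0; lra.
rewrite big_nat_recr//= exprS invfM.
have : 0 <= (4 ^+ n : R)^-1 <= 1.
  by rewrite invr_ge0 exprn_ge0 //= invf_le1 ?exprn_gt0 // exprn_ege1 // ler1n.
move: ((4 ^+ n)^-1) IHn => y IHn /andP[y0 y1].
apply: (@le_trans _ _ ((3^-1 + 2 / 3 * y) * (1 - 2 * (4^-1 * y)))); first nra.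
by rewrite ler_wpM2r//; lra.
Qed.

(** The product is [k! * (s - 1 - k)! / (4 * s) ^ (s - 1)]. The binomial bound compares its
    numerator with [s!], and [leq_expnn_fact] compares [s!] with [s ^ s]; the accumulated factors 4,
    4 and 2 give 32. *)
Lemma prod_distn_fact_ge (R : realFieldType) (s : nat) (k : 'I_s) :
  32^-1 ^+ s <= \prod_(j < s | j != k) (((j - k) + (k - j))%N%:R / (4 * s)%:R) :> R.
Proof.
have s0 : (0 < s)%N by apply: leq_ltn_trans (ltn_ord k).
rewrite (prod_distn R (fun d => d%:R / (4 * s)%:R)).
have E m : \prod_(1 <= d < m.+1) (d%:R / (4 * s)%:R) = m`!%:R / (4 * s)%:R ^+ m :> R.
  elim: m => [|m IHm]; first by rewrite big_geq// fact0 expr0 divr1.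
  by rewrite big_nat_recr//= IHm factS exprS (natrM _ m.+1) invfM [RHS]mulrACA mulrC.
have -> : (s - k = (s.-1 - k).+1)%N by have := ltn_ord k; lia.
rewrite !E mulrACA -invfM -exprD.
have -> : (k + (s.-1 - k) = s.-1)%N by have := ltn_ord k; lia.
rewrite -natrM -natrX ler_pdivlMr ?ltr0n ?expn_gt0 ?muln_gt0 ?s0//.
rewrite exprVn mulrC ler_pdivrMr ?exprn_gt0// -!natrX -natrM ler_nat.
have kle : (k <= s.-1)%N by have := ltn_ord k; lia.
have fact_le : (s`! <= s * (2 ^ s.-1 * (k`! * (s.-1 - k)`!)))%N.
  rewrite -{1}(prednK s0) factS prednK// leq_mul2l -(bin_fact kle).
  by rewrite leq_mul2r leq_bin_expn2 !orbT.
have sE : s = s.-1.+1 by rewrite prednK.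
have h := leq_expnn_fact s.
have {h} : (s ^ s.-1 <= 4 ^ s * (2 ^ s.-1 * (k`! * (s.-1 - k)`!)))%N.
  rewrite -(leq_pmul2l s0) -expnS prednK//; apply: leq_trans h _.
  by rewrite mulnCA leq_mul2l fact_le orbT.
move=> h; rewrite expnMn.
apply: (@leq_trans (4 ^ s.-1 * (4 ^ s * (2 ^ s.-1 * (k`! * (s.-1 - k)`!))))%N).
  by rewrite leq_mul2l h orbT.
rewrite [leqRHS]mulnC; set A := (k`! * _)%N; rewrite 2!mulnA leq_mul2r.
apply/orP; right.
rewrite -mulnA mulnCA -expnMn (_ : 32 ^ s = 4 ^ s * 8 ^ s)%N -?[RHS]expnMn// leq_mul2l.
by rewrite leq_exp2l// leq_pred orbT.
Qed.

(** * The nodes and their Blaschke products *)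

Lemma ratio_ge (R : realFieldType) (c x y : R) :
  0 < c -> 0 < y -> c * y <= x -> 1 - 2 / c <= `|(x - y) / (x + y)|.
Proof.
move=> c0 y0 cyx.
have x0 : 0 < x by apply: lt_le_trans cyx; rewrite mulr_gt0.
apply: le_trans (ler_norm _).
rewrite ler_pdivlMr ?addr_gt0// -subr_ge0.
have -> : x - y - (1 - 2 / c) * (x + y) = 2 / c * (x + y - c * y).
  by field; rewrite gt_eqF.
by rewrite mulr_ge0 ?divr_ge0 ?ltW//; lra.
Qed.

(* [s] geometrically growing clusters, each of [s] equally spaced points. *)
Definition node {R : nzRingType} (c : R) (s : nat) (i : 'I_s * 'I_s) : R :=
  c * (8 ^ i.1 * (s + i.2))%N%:R.

Lemma node_gt0 (R : realFieldType) (c : R) (s : nat) (i : 'I_s * 'I_s) :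
  0 < c -> 0 < node c s i.
Proof.
move=> c0; have := ltn_ord i.1 => i1s.
by rewrite mulr_gt0// ltr0n muln_gt0 expn_gt0/=; lia.
Qed.

(** Inside a cluster the common scale cancels from the ratio, and the remaining denominator
    [2 * s + i.2 + k.2] is at most [4 * s]. *)
Lemma node_ratio_cluster (R : realFieldType) (c : R) (s : nat)
    (i k : 'I_s * 'I_s) : 0 < c -> i.1 = k.1 ->
  (((i.2 - k.2) + (k.2 - i.2))%N%:R / (4 * s)%:R) <=
    `|(node c s k - node c s i) / (node c s k + node c s i)|.
Proof.
move=> c0 ik; have s0 : (0 < s)%N by apply: leq_ltn_trans (ltn_ord i.1).
have i2 := ltn_ord i.2; have k2 := ltn_ord k.2.
have -> : (node c s k - node c s i) / (node c s k + node c s i) =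
    (k.2%:R - i.2%:R) / (s + k.2 + (s + i.2))%:R.
  rewrite /node ik !natrM !natrD.
  have ? : (8 ^ k.1)%:R != 0 :> R by rewrite pnatr_eq0 -lt0n expn_gt0.
  have ? : s%:R + k.2%:R + (s%:R + i.2%:R) != 0 :> R.
    by rewrite -!natrD pnatr_eq0; lia.
 by field; rewrite -!mulrDr !mulf_neq0 ?(gt_eqF c0)// andbT.
rewrite normrM normfV [`|(_ + _)%:R|]ger0_norm//.
rewrite (_ : `|_| = ((i.2 - k.2) + (k.2 - i.2))%:R); last first.
  have [h|h] := leqP i.2 k.2.
    rewrite ger0_norm ?subr_ge0 ?ler_nat// -natrB//; congr _%:R; lia.
  rewrite ltr0_norm ?subr_lt0 ?ltr_nat// opprB -natrB//; [congr _%:R; lia|lia].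
by rewrite ler_wpM2l// lef_pV2 ?posrE ?ltr0n ?ler_nat; lia.
Qed.

(** The points of one cluster lie within a factor 2 of each other, so two clusters at distance
    [d >= 1] are separated by a factor at least [8 ^ d / 2 >= 4 ^ d]. *)
Lemma node_ratio_far (R : realFieldType) (c : R) (s : nat)
    (i k : 'I_s * 'I_s) : 0 < c -> i.1 != k.1 ->
  1 - 2 / 4 ^+ ((i.1 - k.1) + (k.1 - i.1))%N <=
    `|(node c s k - node c s i) / (node c s k + node c s i)|.
Proof.
wlog ik : i k / (i.1 < k.1)%N => [wl c0 ik|c0 _].
  have := ik; rewrite -val_eqE neq_ltn => /orP[ltik|ltki]; first exact: wl.
  rewrite addnC normrM distrC [_ + node c s i]addrC -normrM.
  by apply: wl; rewrite // eq_sym.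
have s0 : (0 < s)%N by apply: leq_ltn_trans (ltn_ord i.1).
apply: ratio_ge; rewrite ?exprn_gt0// ?node_gt0//.
rewrite /node mulrCA ler_pM2l// -natrX -natrM ler_nat.
have i2 := ltn_ord i.2; have k2 := ltn_ord k.2.
have -> : (i.1 - k.1 + (k.1 - i.1) = k.1 - i.1)%N by lia.
have -> : (8 ^ k.1 = 4 ^ (k.1 - i.1) * 2 ^ (k.1 - i.1) * 8 ^ i.1)%N.
  by rewrite -expnMn -expnD subnK// ltnW.
rewrite -!mulnA leq_mul2l; apply/orP; right.
rewrite mulnCA leq_mul2l; apply/orP; right.
apply: (@leq_trans (2 * s)); first lia.
rewrite leq_mul//; last by rewrite leq_addr.
by rewrite -[X in (X <= _)%N]expn1 leq_exp2l// subn_gt0.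
Qed.

(** The cluster of [k] contributes at least [32 ^- s]. In the other clusters, each of the [s]
    positions contributes a product over the clusters on the left and one over those on the right,
    both at least 1/3, hence [9 ^- s] in all. Finally [32 * 9 <= 2 ^ 9]. *)
Lemma node_prod_ge (R : realFieldType) (c : R) (s : nat) (k : 'I_s * 'I_s) :
  0 < c ->
  (2 ^+ s)^-1 ^+ 9 <= `|\prod_(i | i != k)
    ((node c s k - node c s i) / (node c s k + node c s i))|.
Proof.
move=> c0; rewrite normr_prod.
set F := fun i => `|(node c s k - node c s i) / (node c s k + node c s i)|.
have -> : \prod_(i | i != k) F i =
    \prod_q \prod_(j | (q, j) != k) F (q, j).
  by rewrite pair_big_dep /=; apply: eq_big => [[]|[]].
rewrite (bigD1 k.1)//=.
have : (2 ^+ s)^-1 ^+ 9 <= 32^-1 ^+ s * 9^-1 ^+ s :> R.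
  rewrite (exprD _ 5 4) -!exprVn -!exprM ![(s * _)%N]mulnC !exprM.
  rewrite (_ : 2^-1 ^+ 5 = 32^-1 :> R); last by field.
  by rewrite ler_wpM2l ?exprn_ge0// lerXn2r ?nnegrE ?exprn_ge0//; lra.
move/le_trans; apply.
rewrite ler_pM ?exprn_ge0//.
  apply: le_trans (prod_distn_fact_ge R s k.2) _.
  rewrite (eq_bigl (fun j : 'I_s => j != k.2)); last first.
    by move=> j; case: k {F} => k1 k2 /=; rewrite xpair_eqE eqxx.
  apply: ler_prod => j _; rewrite divr_ge0//=.
  exact: (@node_ratio_cluster _ _ _ (k.1, j)).
apply: (@le_trans _ _ (\prod_(q < s | q != k.1)
    (1 - 2 / 4 ^+ ((q - k.1) + (k.1 - q))%N) ^+ s)).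
  rewrite prodrXl lerXn2r ?nnegrE//; last first.
  - rewrite (prod_distn R (fun d => 1 - 2 / 4 ^+ d)).
    have := prod_oneB_exprV4_ge R k.1.+1; have := prod_oneB_exprV4_ge R (s - k.1).
    by set u := \prod_(_ <= _ < _) _; set v := \prod_(_ <= _ < _) _ => ? ?; nra.
  - rewrite (prod_distn R (fun d => 1 - 2 / 4 ^+ d)).
    have := prod_oneB_exprV4_ge R k.1.+1; have := prod_oneB_exprV4_ge R (s - k.1).
    by set u := \prod_(_ <= _ < _) _; set v := \prod_(_ <= _ < _) _ => ? ?; nra.
apply: ler_prod => q qk.
have d0 : 0 <= 1 - 2 / 4 ^+ ((q - k.1) + (k.1 - q))%N :> R.
  rewrite subr_ge0 ler_pdivrMr ?exprn_gt0// mul1r -natrX ler_nat.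
  apply: (@leq_trans (4 ^ 1)) => //; rewrite leq_exp2l//.
  by move: qk; rewrite -val_eqE /= neq_ltn => /orP[] h; lia.
rewrite exprn_ge0//=.
rewrite (eq_bigl predT); last first.
  by move=> j; case: k qk {F d0} => k1 k2 /=; rewrite xpair_eqE => /negbTE ->.
rewrite -[X in _ ^+ X]card_ord -prodr_const; apply: ler_prod => j _.
by rewrite d0 /=; exact: (@node_ratio_far _ _ _ (q, j)).
Qed.

(** * Finite exponential sums as members of the class; measurability *)

Lemma exists_atomic_measure (R : realType) (I : Type) (r : seq I) (w x : I -> R) :
    (forall i, 0 <= w i) -> (forall i, 0 <= x i) ->
  exists mu : {measure set (measurableTypeR R) -> \bar R},
    [/\ on_nonneg mu, mu setT = (\sum_(i <- r) w i)%:E &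
      forall f : R -> R, measurable_fun setT f -> (forall y, 0 <= f y) ->
        (\int[mu]_(y in `[0%R, +oo[) (f y)%:E)%E =
          (\sum_(i <- r) w i * f (x i))%:E].
Proof.
move=> w0 x0; elim: r => [|i r [mu [mu0 muT muf]]].
  exists mzero; split => [//||f mf f0]; first by rewrite big_nil.
  by rewrite integral_measure_zero big_nil.
pose nu : {measure set (measurableTypeR R) -> \bar R} :=
  mscale (NngNum (w0 i)) (\d_(x i : measurableTypeR R)).
have mI : measurable (`[0%R, +oo[%classic : set (measurableTypeR R)).
  exact: measurable_itv.
exists (measure_add nu mu); split => [||f mf f0].
- rewrite /on_nonneg [LHS]measure_addE [X in (_ + X)%E]mu0 adde0.
  rewrite /nu /= /mscale /= diracE memNset ?mule0//=.
  by rewrite in_itv /= ltNge x0.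
- rewrite [LHS]measure_addE muT /nu /= /mscale /= diracT mule1 big_cons.
  by rewrite EFinD.
have mfI : measurable_fun (`[0%R, +oo[%classic : set R) (EFin \o f).
  by apply/measurable_EFinP; apply: measurable_funTS.
rewrite ge0_integral_measure_add//; last by move=> y _; rewrite lee_fin.
rewrite muf// /nu ge0_integral_mscale//; last by move=> y _; rewrite lee_fin.
rewrite integral_dirac// diracE mem_set ?mul1e/=; last first.
  by rewrite in_itv /= x0.
by rewrite big_cons.
Qed.

(** The value 0 at negative [t] is the convention by which [M_infty] extends functions to the
    line. *)
Definition exp_sum {R : realType} {I : finType} (x w : I -> R) (t : R) : R :=
  if t < 0 then 0 else \sum_i w i * expR (- (t * x i)).

Lemma exp_sum_M_infty (R : realType) (I : finType) (x w : I -> R) :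
    (forall i, 0 <= w i) -> (forall i, 0 <= x i) -> \sum_i w i <= 1 ->
  M_infty (exp_sum x w).
Proof.
move=> w0 x0 w1; split=> [t t0|]; first by rewrite /exp_sum t0.
have [mu [mu0 muT muf]] := @exists_atomic_measure R I (index_enum I) _ _ w0 x0.
exists mu; split => [//||t t0]; first by rewrite muT lee_fin.
rewrite (muf (fun y => expR (- (t * y)))); last 2 first.
- by apply: measurableT_comp => //; apply: measurableT_comp.
- by move=> y; exact: expR_ge0.
by rewrite /exp_sum ltNge t0.
Qed.

Lemma measurable_M_infty (R : realType) (f : R -> R) :
  M_infty f -> measurable_fun setT (f : measurableTypeR R -> R).
Proof.
move=> [f0 [mu [mu0 mu1 muf]]].
have mI : measurable (`[0%R, +oo[%classic : set (measurableTypeR R)).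
  exact: measurable_itv.
have mexp t : measurable_fun (`[0%R, +oo[%classic : set R)
    (fun x => (expR (- (t * x)))%:E).
  apply: measurable_funTS; apply/measurable_EFinP.
  by apply: measurableT_comp => //; apply: measurableT_comp.
(* Extending [f] to the left by the constant [f 0] gives a function that is nonincreasing on the
   whole line, hence measurable. *)
pose g t := f (Num.max t 0).
have fE : f = fun t => if t \in `[0%R, +oo[ then g t else cst 0 t.
  apply/funext => t; rewrite in_itv/= andbT; case: leP => t0; last exact: f0.
  by rewrite /g max_l.
rewrite fE; apply: measurable_fun_ifT => //.
  apply: (measurable_fun_bool true); rewrite setTI.
  by rewrite (_ : _ @^-1` _ = `[0%R, +oo[%classic).
apply: nonincreasing_measurable => // s t st.
rewrite /g -lee_fin !muf ?le_max ?lexx ?orbT//.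
apply: ge0_le_integral => //.
- exact: mexp.
- exact: mexp.
move=> y; rewrite /= in_itv/= andbT => y0.
by rewrite lee_fin ler_expR lerN2 ler_wpM2r// ge_max !le_max st lexx orbT.
Qed.

(** * Distances in L^p and separated families *)

Lemma le_poweR (R : realType) (r : R) (a b : \bar R) :
  0 <= r -> (0 <= a)%E -> (a <= b)%E -> (a `^ r <= b `^ r)%E.
Proof.
move=> r0 a0 ab; apply: gt0_ler_poweR => //; rewrite in_itv/= leey andbT//.
exact: le_trans ab.
Qed.

Lemma le_Lnorm (d : measure_display) (T : measurableType d) (R : realType)
    (nu : {measure set T -> \bar R}) (p : R) (f g : T -> R) : 0 < p ->
  measurable_fun setT f -> measurable_fun setT g ->
  (forall t, `|f t| <= `|g t|) ->
  ('N[nu]_p%:E [EFin \o f] <= 'N[nu]_p%:E [EFin \o g])%E.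
Proof.
move=> p0 mf mg fg; rewrite unlock /Lnorm.
have mp (h : T -> R) : measurable_fun setT h ->
    measurable_fun setT (fun x => `|(EFin \o h) x| `^ p)%E.
  move=> mh; apply: (measurableT_comp (measurable_poweR _)).
  by apply: measurableT_comp => //; exact/measurable_EFinP.
have i0 (h : T -> R) : (0 <= \int[nu]_x (`|(EFin \o h) x| `^ p))%E.
  by apply: integral_ge0 => x _; exact: poweR_ge0.
apply: le_poweR; rewrite ?invr_ge0 ?(ltW p0)//.
apply: ge0_le_integral => //.
- by move=> x _; exact: poweR_ge0.
- exact: mp.
- exact: mp.
by move=> x _; rewrite le_poweR ?lee_fin ?(ltW p0).
Qed.

Lemma Lp_dist_triangle (d : measure_display) (T : measurableType d) (R : realType)
    (nu : {measure set T -> \bar R}) (p : R) (f g h : T -> R) : 1 <= p ->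
    measurable_fun setT f -> measurable_fun setT g -> measurable_fun setT h ->
  (Lp_dist nu p f g <= Lp_dist nu p f h + Lp_dist nu p g h)%E.
Proof.
move=> p1 mf mg mh; rewrite /Lp_dist.
rewrite (_ : f \- g = (f \- h) \+ (h \- g)); last first.
  by apply/funext => x /=; rewrite subrKA.
apply: (le_trans (minkowski_EFin _ _ _ _)) => //;
  [exact: measurable_funB|exact: measurable_funB|].
apply: leeD => //; apply: le_Lnorm; rewrite ?(lt_le_trans _ p1)//.
- exact: measurable_funB.
- exact: measurable_funB.
- by move=> t; rewrite distrC.
Qed.

(** Two members of the family in the same open ball of radius [eps] would be at distance less than
    [2 * eps]; so sending each member to a ball that contains it is injective. *)
Lemma separated_covering (d : measure_display) (T : measurableType d)
    (R : realType) (nu : {measure set T -> \bar R}) (p eps : R) (P : finType)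
    (g : P -> T -> R) (F : set (T -> R)) : 1 <= p ->
    (forall i, F (g i)) -> (forall i, measurable_fun setT (g i)) ->
    (forall i j, i != j -> ((2 * eps)%:E <= Lp_dist nu p (g i) (g j))%E) ->
  (#|P|%:R%:E <= Lp_covering_number nu p eps F)%E.
Proof.
move=> p1 Fg mg sep; apply/le_ereal_inf_tmp => _ [n [c [cE cF]] <-].
rewrite lee_fin ler_nat.
have /choice[phi phiP] (i : P) : exists k : 'I_n,
    (Lp_dist nu p (g i) (c k) < eps%:E)%E.
  by have [k _ gk] := cF _ (Fg i); exists k.
rewrite -[n]card_ord; apply: (@leq_card _ _ phi) => i j ij.
apply/eqP; apply: contraT => /sep; rewrite leNgt => /negP[].
have mc k : measurable_fun setT (c k).
  by have := cE k; rewrite /Lp_space /= inE => /andP[]; rewrite inE.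
apply: le_lt_trans (@Lp_dist_triangle _ _ _ nu _ _ _ _ p1 (mg i) (mg j) (mc (phi i))) _.
by rewrite mulr_natl mulr2n EFinD lteD// ij.
Qed.

(** Reduces a lower bound on the L^2 distance to an integral of a square, with [h] a closed formula
    for the difference that is valid on [0, 1] only. *)
Lemma lebesgue01_dist_ge (R : realType) (f g h : R -> R) (c : R) : 0 <= c ->
    measurable_fun setT (f : measurableTypeR R -> R) ->
    measurable_fun setT (g : measurableTypeR R -> R) ->
    (forall t, 0 <= t <= 1 -> f t - g t = h t) ->
    ((c ^+ 2)%:E <= \int[@lebesgue_measure R]_(t in `[0%R, 1%R]) (h t ^+ 2)%:E)%E ->
  (c%:E <= Lp_dist (lebesgue01 R) 2 f g)%E.
Proof.
move=> c0 mf mg fgh hc; rewrite /Lp_dist unlock.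
have cE : c%:E = ((c ^+ 2)%:E `^ 2^-1)%E.
  by rewrite poweR_EFin powR12_sqrt ?sqr_ge0// sqrtr_sqr ger0_norm.
have mI : measurable (`[0%R, 1%R]%classic : set (measurableTypeR R)).
  exact: measurable_itv.
have mfg : measurable_fun setT (fun t : measurableTypeR R =>
    `|(EFin \o (f \- g)%R) t| `^ 2)%E.
  apply: (measurableT_comp (measurable_poweR _)).
  apply: measurableT_comp => //; apply/measurable_EFinP.
  exact: measurable_funB.
rewrite cE; apply: le_poweR; rewrite ?lee_fin ?sqr_ge0//.
apply: (le_trans hc).
apply: (@le_trans _ _ (\int[lebesgue01 R]_(t in `[0%R, 1%R])
    (`|(EFin \o (f \- g)%R) t| `^ 2))%E); last first.
  by apply: ge0_subset_integral => // x _; exact: poweR_ge0.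
rewrite le_eqVlt; apply/orP; left; apply/eqP.
rewrite [RHS](eq_measure_integral (@lebesgue_measure R)); last first.
  move=> A mA AI; rewrite /lebesgue01 /= /mrestr setIidl//.
apply: eq_integral => t; rewrite inE /= in_itv /= => /fgh <-.
by rewrite powR_mulrn// real_normK// num_real.
Qed.

(** * The L^2 norm of an exponential sum on [0, 1] *)

Lemma is_derive_bigsum (R : realType) (I : Type) (r : seq I) (h : I -> R -> R)
    (dh : I -> R) (t : R) : (forall i, is_derive t (1 : R) (h i) (dh i)) ->
  is_derive t (1 : R) (\sum_(i <- r) h i) (\sum_(i <- r) dh i).
Proof.
move=> hd; elim: r => [|i r IHr].
  by rewrite !big_nil; exact: (is_derive_cst (0 : R)).
by rewrite !big_cons; exact: is_deriveD.
Qed.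

(** A primitive of the squared sum is minus the Cauchy form of the damped coefficients
    [a i * expR (- (t * x i))]. Its value at 0 yields the full form, and its value at 1 the
    contribution of the half-line beyond 1. *)
Lemma integral_exp_sum_sqr (R : realType) (I : finType) (x a : I -> R) :
    (forall i, 0 < x i) ->
  (\int[@lebesgue_measure R]_(t in `[0%R, 1%R])
      ((\sum_i a i * expR (- (t * x i))) ^+ 2)%:E)%E =
  (cauchy_form x a - cauchy_form x (fun i => a i * expR (- x i)))%:E.
Proof.
move=> x0.
pose F t := - cauchy_form x (fun i => a i * expR (- (t * x i))).
pose h t := (\sum_i a i * expR (- (t * x i))) ^+ 2.
have dexp (c t : R) : is_derive t 1 (fun t => expR (- (t * c))) (- c * expR (- (t * c))).
  apply: is_derive_eq; rewrite !scaler0 !add0r /GRing.scale /=; ring.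
have expRxy (t u v : R) :
    expR (- (t * (u + v))) = expR (- (t * u)) * expR (- (t * v)).
  by rewrite mulrDr opprD expRD.
have dF (t : R) : is_derive t 1 F (h t).
  rewrite /F /cauchy_form.
  have E : (fun t => - (\sum_i \sum_j a i * expR (- (t * x i)) *
        (a j * expR (- (t * x j))) / (x i + x j))) =
      - \sum_i \sum_j ((a i * a j / (x i + x j)) \*: 
         (fun t => expR (- (t * (x i + x j))))).
    apply/funext => u; rewrite fctE fct_sumE; congr (- _).
    apply: eq_bigr => i _; rewrite fct_sumE; apply: eq_bigr => j _ /=.
    by rewrite (expRxy u) /GRing.scale/=; ring.
  rewrite E.
  have dd : is_derive t 1 (\sum_i \sum_j ((a i * a j / (x i + x j)) \*: 
         (fun t => expR (- (t * (x i + x j)))))) (\sum_i \sum_j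
    (a i * a j / (x i + x j) *: (- (x i + x j) * expR (- (t * (x i + x j)))))).
    apply: is_derive_bigsum => i; apply: is_derive_bigsum => j.
  apply: is_derive_eq; rewrite /h expr2 big_distrlr /= -sumrN.
  apply: eq_bigr => i _; rewrite -sumrN; apply: eq_bigr => j _.
  rewrite (expRxy t) /GRing.scale/=.
  by field; rewrite gt_eqF ?addr_gt0.
have cS : continuous (fun t : R => \sum_i a i * expR (- (t * x i))).
  apply: continuous_big => [|i _ t]; first exact: add_continuous.
  apply: cvgM; first exact: cvg_cst.
  apply: continuous_comp; last exact: continuous_expR.
  by apply: cvgN; apply: cvgMl; exact: cvg_id.
have ch : continuous h by move=> t; exact: (cvgM (cS t) (cS t)).
rewrite (@continuous_FTC2 _ h F 0 1)//.
- rewrite -EFinB; congr (_%:E); rewrite /F opprK addrC; congr (_ - _).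
    by congr cauchy_form; apply/funext => i; rewrite mul0r oppr0 expR0 mulr1.
  by congr cauchy_form; apply/funext => i; rewrite mul1r.
- exact: continuous_subspaceT.
- have cF (t : R) : {for t, continuous F}.
    by apply: differentiable_continuous; apply/derivable1_diffP; case: (dF t).
  split; [by move=> t _; case: (dF t)| |].
  + by apply: cvg_at_right_filter; exact: cF.
  + by apply: cvg_at_left_filter; exact: cF.
- by move=> t _; rewrite derive1E; case: (dF t).
Qed.

(** * Lower bound for the covering numbers *)

(** The hypothesis is that [a k] is at least one mesh of the grid of weights. With [y = 2 ^+ s],
    this mesh is at least [y ^- 3], the node at most [40 * y ^+ 4] and the Blaschke product at least
    [y ^- 9], so the form is at least [y ^- 28 / 80]. The factor 5 leaves 4 for the square of
    [2 * eps] and 1 for the tail beyond 1. *)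
Lemma cauchy_form_node_ge (R : realFieldType) (s : nat) (a : 'I_s * 'I_s -> R)
    (k : 'I_s * 'I_s) : (2 ^ s * s ^ 2)%:R^-1 <= `|a k| ->
  5 * ((2 ^+ s) ^- 20) ^+ 2 <= cauchy_form (node 20 s) a.
Proof.
move=> ak; have s0 : (0 < s)%N by apply: leq_ltn_trans (ltn_ord k.1).
have x0 i : 0 < node 20 s i :> R by apply: node_gt0.
apply: le_trans (@cauchy_form_ge _ _ _ a k x0).
rewrite -[a k ^+ 2]real_normK ?num_real// -[X in _ <= _ * X]real_normK ?num_real//.
have Py := @node_prod_ge R 20 s k (ltr0n _ _).
move: (x0 k) ak Py; set X := node _ _ _; set A := `|a k|; set P := `|_| => X0 AN.
set y : R := 2 ^+ s => Py.
have y2 : 2 <= y by rewrite /y -{1}[2]expr1 ler_eXn2l ?ltr1n.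
have sy : s%:R <= y by rewrite /y -natrX ler_nat ltnW// ltn_expl.
have y0 : 0 < y by rewrite exprn_gt0.
have yA : (y ^+ 3)^-1 <= A.
  apply: le_trans AN; rewrite lef_pV2 ?posrE ?exprn_gt0//; last first.
    by rewrite ltr0n muln_gt0 !expn_gt0 s0.
  rewrite natrM !natrX [leRHS]exprS ler_wpM2l ?(ltW y0)//.
  by rewrite lerXn2r ?nnegrE ?(ltW y0).
have Xy : X <= 40 * y ^+ 4.
  rewrite /X /node natrM natrX.
  have h8 : 8 ^+ k.1 <= y ^+ 3.
    rewrite /y -exprM mulnC exprM (_ : 2 ^+ 3 = 8); last by ring.
    by rewrite ler_eXn2l ?ltr1n// ltnW.
  have hs : (s + k.2)%:R <= 2 * y.
    apply: (@le_trans _ _ (2 * s%:R)); last by rewrite ler_pM2l.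
    by rewrite -natrM ler_nat; have := ltn_ord k.2; clear; lia.
  rewrite (_ : 40 * y ^+ 4 = 20 * (y ^+ 3 * (2 * y))); last by ring.
  by rewrite ler_pM2l// ler_pM// ?exprn_ge0.
move: y y0 y2 X X0 A P yA Xy Py {sy AN} => y y0 y2 X X0 A P yA Xy Py.
have y3 : 0 <= (y ^+ 3)^-1 by rewrite invr_ge0 exprn_ge0// ltW.
have y9 : 0 <= y^-1 ^+ 9 by rewrite exprn_ge0// invr_ge0 ltW.
apply: (@le_trans _ _ (((y ^+ 3)^-1) ^+ 2 / (2 * (40 * y ^+ 4)) * (y^-1 ^+ 9) ^+ 2)).
  have -> : ((y ^+ 3)^-1) ^+ 2 / (2 * (40 * y ^+ 4)) * (y^-1 ^+ 9) ^+ 2 =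
      80^-1 * y ^- 28 by field; rewrite gt_eqF.
  have -> : 5 * (y ^- 20) ^+ 2 = 5 * y ^- 12 * y ^- 28 by field; rewrite gt_eqF.
  rewrite ler_wpM2r ?invr_ge0 ?exprn_ge0 ?(ltW y0)//.
  rewrite ler_pdivrMr ?exprn_gt0//.
  have : 2 ^+ 12 <= y ^+ 12 by rewrite lerXn2r ?nnegrE ?(ltW y0).
  have -> : 2 ^+ 12 = 4096%:R :> R by rewrite -natrX.
  by lra.
have X2 : (2 * (40 * y ^+ 4))^-1 <= (2 * X)^-1.
  by rewrite lef_pV2 ?posrE ?mulr_gt0 ?exprn_gt0// ler_pM2l.
have X3 : 0 <= (2 * (40 * y ^+ 4))^-1 by rewrite invr_ge0 !mulr_ge0 ?exprn_ge0 ?ltW.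
apply: ler_pM; [by rewrite mulr_ge0 ?exprn_ge0|by rewrite exprn_ge0| |].
- by apply: ler_pM; rewrite ?exprn_ge0// lerXn2r ?nnegrE ?(le_trans y3).
- by rewrite lerXn2r ?nnegrE ?(le_trans y9).
Qed.

(** As the denominators are at least 1, the form is at most the square of the sum of the [|a i|]. *)
Lemma cauchy_form_le (R : realFieldType) (I : finType) (x a : I -> R) (e : R) :
    (forall i, 1 <= x i) -> (forall i, `|a i| <= e / #|I|%:R) ->
  cauchy_form x a <= e ^+ 2.
Proof.
move=> x1 ae; case: (posnP #|I|) => [I0|I0].
  rewrite /cauchy_form big1 ?sqr_ge0// => i.
  by have := card0_eq I0 i; rewrite inE.
have IR : 0 < #|I|%:R :> R by rewrite ltr0n.
have eE : e = \sum_(i : I) e / #|I|%:R.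
  by rewrite sumr_const -[RHS]mulr_natr divfK ?gt_eqF.
rewrite expr2 {1 2}eE big_distrlr /=.
apply: ler_sum => i _; apply: ler_sum => j _.
have xij : 1 <= x i + x j by have := x1 i; have := x1 j; lra.
apply: le_trans (ler_norm _) _.
rewrite normrM normfV [`|x i + x j|]ger0_norm; last by lra.
rewrite ler_pdivrMr; last by lra.
rewrite normrM; apply: (@le_trans _ _ (e / #|I|%:R * (e / #|I|%:R))).
  by rewrite ler_pM.
by rewrite ler_peMr// mulr_ge0// (le_trans _ (ae i)).
Qed.

(** All nodes are at least [20 * s], and [expR 1 >= 2]; the scale 20 is chosen so that the tail
    matches the separation [2 ^ (- 20 s)]. *)
Lemma expR_node_le (R : realType) (s : nat) (i : 'I_s * 'I_s) :
  expR (- node 20 s i) <= (2 ^+ s) ^- 20 :> R.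
Proof.
rewrite expRN lef_pV2 ?posrE ?expR_gt0 ?exprn_gt0// -exprM mulnC.
apply: (@le_trans _ _ (expR ((20 * s)%:R))).
  rewrite -[X in expR X]mulr1 expRM_natl lerXn2r ?nnegrE ?expR_ge0//.
  exact: expR_ge1Dx.
rewrite ler_expR /node natrM ler_pM2l// ler_nat.
by rewrite (leq_trans (leq_addr i.2 s))// leq_pmull// expn_gt0.
Qed.

Lemma covering_number_packing (R : realType) (s : nat) (eps : R) : (0 < s)%N ->
  0 < eps <= (2 ^+ s) ^- 20 ->
  ((2 ^ (s ^ 3))%:R%:E <= Lp_covering_number (lebesgue01 R) 2 eps (@M_infty R))%E.
Proof.
move=> s0 /andP[eps0 epsE].
pose P : finType := {ffun 'I_s * 'I_s -> 'I_(2 ^ s)}.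
have -> : (2 ^ (s ^ 3))%N = #|P|.
  by rewrite card_ffun card_prod !card_ord -expnM.
(* With this denominator, [s ^ 2] weights with numerators below [2 ^ s] have total mass at most
   1. *)
pose N : R := (2 ^ s * s ^ 2)%:R.
have N0 : 0 < N by rewrite ltr0n muln_gt0 !expn_gt0 s0.
pose w (f : P) i : R := (f i)%:R / N.
pose x : 'I_s * 'I_s -> R := node 20 s.
have x0 i : 0 < x i by apply: node_gt0.
have x20 i : 1 <= x i.
  rewrite /x /node -[20 as X in _ <= X * _]/(20%:R) -natrM ler1n !muln_gt0 expn_gt0/=.
  by have := ltn_ord i.1; lia.
have M_ f : M_infty (exp_sum x (w f)).
  apply: exp_sum_M_infty => [i|i|].
  - by rewrite divr_ge0// ltW.
  - exact: ltW.
  rewrite -mulr_suml ler_pdivrMr// mul1r -natr_sum ler_nat.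
  apply: (@leq_trans (\sum_(i : 'I_s * 'I_s) 2 ^ s)).
    by apply: leq_sum => i _; apply: ltnW.
  by rewrite sum_nat_const card_prod card_ord mulnC.
have := @separated_covering _ _ R (lebesgue01 R) 2 eps P (fun f => exp_sum x (w f))
  (@M_infty R).
apply.
- by rewrite ler1n.
- exact: M_.
- by move=> f; apply: measurable_M_infty.
move=> f g fg; pose a i := w f i - w g i.
apply: (@lebesgue01_dist_ge _ _ _ (fun t => \sum_i a i * expR (- (t * x i)))).
- by rewrite mulr_ge0// ltW.
- exact: measurable_M_infty.
- exact: measurable_M_infty.
- move=> t /andP[t0 _]; rewrite /exp_sum ltNge t0 /= -sumrB.
  by apply: eq_bigr => i _; rewrite /a mulrBl.
rewrite integral_exp_sum_sqr// lee_fin.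
pose E : R := (2 ^+ s) ^- 20.
have E0 : 0 <= E by rewrite invr_ge0 !exprn_ge0.
have [k fgk] : exists k, f k != g k.
  apply/existsP; apply: contraNT fg => /existsPn h.
  by apply/eqP/ffunP => i; apply/eqP; have := h i; rewrite negbK.
have aE i : `|a i| = `|(f i)%:R - (g i)%:R| / N.
  by rewrite /a /w -mulrBl normrM normfV (ger0_norm (ltW N0)).
have Qlow : 5 * E ^+ 2 <= cauchy_form x a.
  apply: (cauchy_form_node_ge _ _ _ k); rewrite aE -/N ler_pdivlMr// mulVf ?gt_eqF//.
  move: fgk; rewrite -val_eqE /= neq_ltn => /orP[] h.
    by rewrite distrC -natrB ?(ltnW h)// ger0_norm// ler1n subn_gt0.
  by rewrite -natrB ?(ltnW h)// ger0_norm// ler1n subn_gt0.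
(* Two weights differ by at most [1 / s ^ 2], there are [s ^ 2] nodes, and each exponential is at
   most [E]. *)
have Qtail : cauchy_form x (fun i => a i * expR (- x i)) <= E ^+ 2.
  apply: cauchy_form_le => // i.
  rewrite normrM (ger0_norm (expR_ge0 _)) mulrC ler_pM ?expR_ge0 ?expR_node_le//.
  rewrite aE card_prod card_ord /N natrM invfM mulrA mulrC ler_piMr ?invr_ge0//.
  rewrite ler_pdivrMr ?ltr0n ?expn_gt0// mul1r.
  have := ltn_ord (f i); have := ltn_ord (g i) => hg hf.
  rewrite ler_norml; apply/andP; split.
    by rewrite lerNl opprB lerBlDr (le_trans (y := (2 ^ s)%:R)) ?lerDl// ler_nat ltnW.
  by rewrite lerBlDr (le_trans (y := (2 ^ s)%:R)) ?lerDl// ler_nat ltnW.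
have : eps ^+ 2 <= E ^+ 2 by rewrite lerXn2r ?nnegrE// ltW.
rewrite exprMn; lra.
Qed.

(** The sums with the single node 0 and weight 0 or 1 are at distance 1 in L^2(0, 1). This covers
    the values of [eps] too large for a packing of rank [s > 0]. *)
Lemma covering_number_ge2 (R : realType) (eps : R) : 0 < eps < 4^-1 ->
  (2%:E <= Lp_covering_number (lebesgue01 R) 2 eps (@M_infty R))%E.
Proof.
move=> /andP[eps0 eps4].
have sum1 (F : unit -> R) : \sum_i F i = F tt.
  by rewrite (bigD1 tt)//= big1 ?addr0// => -[].
pose w (b : bool) (_ : unit) : R := b%:R.
pose x (_ : unit) : R := 0.
have M_ b : M_infty (exp_sum x (w b)).
  apply: exp_sum_M_infty => //; rewrite sum1.
  by case: b; rewrite /w.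
have -> : 2%:E = #|{: bool}|%:R%:E :> \bar R by rewrite card_bool.
have := @separated_covering _ _ R (lebesgue01 R) 2 eps bool
  (fun b => exp_sum x (w b)) (@M_infty R).
apply.
- by rewrite ler1n.
- exact: M_.
- by move=> b; apply: measurable_M_infty.
move=> b c bc.
apply: (@lebesgue01_dist_ge _ _ _ (fun t => (b%:R - c%:R))).
- by rewrite mulr_ge0// ltW.
- exact: measurable_M_infty.
- exact: measurable_M_infty.
- move=> t /andP[t0 _]; rewrite /exp_sum ltNge t0 /= !sum1.
  by rewrite /x mulr0 oppr0 expR0 !mulr1.
rewrite (_ : (b%:R - c%:R) ^+ 2 = 1); last first.
  by case: b c bc => [] [] //= _; rewrite ?subr0 ?sub0r ?sqrrN expr1n.
rewrite integral_cst//= lebesgue_measure_itv/= lte01 oppr0 adde0 mule1 lee_fin.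
by rewrite exprMn; nra.
Qed.

Lemma le_lne (R : realType) (x y : \bar R) : (0 <= x)%E -> (x <= y)%E ->
  (lne x <= lne y)%E.
Proof.
move=> x0 xy; rewrite lee_lne// in_itv/= leey ?x0// andbT.
exact: le_trans xy.
Qed.

Lemma lne_natX (R : realType) (m n : nat) : (0 < m)%N ->
  lne ((m ^ n)%:R%:E : \bar R) = (n%:R * ln m%:R)%:E.
Proof.
move=> m0; rewrite lne_EFin ?ltr0n ?expn_gt0 ?m0// natrX.
by rewrite lnXn ?ltr0n// mulr_natl.
Qed.

Lemma lne_covering_number_ge (R : realType) : exists2 c : R, 0 < c &
  forall eps : R, 0 < eps < 4^-1 ->
    ((c * `|ln eps| ^+ 3)%:E <=
      lne (Lp_covering_number (lebesgue01 R) 2 eps (@M_infty R)))%E.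
Proof.
have l2 : 0 < ln 2 :> R by rewrite ln_gt0 ?ltr1n.
(* For [s >= 1] below, [|ln eps|] is less than [20 * ln 2 * (s + 1)], hence than [40 * ln 2 * s],
   while the packing gives [s ^ 3 * ln 2]. *)
exists (ln 2 / (40 * ln 2) ^+ 3); first by rewrite divr_gt0 ?exprn_gt0 ?mulr_gt0.
move=> eps eps4; have /andP[eps0 epslt] := eps4.
have lneps : `|ln eps| = - ln eps.
  by rewrite ler0_norm// ln_le0//; lra.
have L0 : 0 <= `|ln eps| / (20 * ln 2) by rewrite divr_ge0 ?mulr_ge0 ?(ltW l2).
(* This [s] is the largest rank with [eps <= 2 ^ (- 20 s)]. *)
have /andP[] := truncn_itv L0; set s := Num.truncn _.
rewrite ler_pdivlMr ?mulr_gt0// ltr_pdivrMr ?mulr_gt0// => sL Ls.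
have [s0|s0] := posnP s.
  apply: (@le_trans _ _ (ln 2)%:E).
    rewrite lee_fin mulrAC ler_pdivrMr ?exprn_gt0 ?mulr_gt0// ler_pM2l//.
    rewrite lerXn2r ?nnegrE ?mulr_ge0 ?(ltW l2)// (ltW (lt_le_trans Ls _))// s0 mul1r.
    by rewrite ler_pM2r// ler_nat.
  have := le_lne _ _ _ _ (covering_number_ge2 _ _ eps4).
  by rewrite lne_EFin// lee_fin; apply.
have : 0 < eps <= (2 ^+ s) ^- 20.
  rewrite eps0 /= -ler_ln ?posrE ?invr_gt0 ?exprn_gt0//.
  rewrite lnV ?posrE ?exprn_gt0// !lnXn ?exprn_gt0// lerNr -lneps.
  by apply: le_trans sL; rewrite -mulrnA -[leLHS]mulr_natl natrM; lra.
move=> /(covering_number_packing _ _ _ s0) /(le_lne _ _ _ _).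
rewrite lne_natX// => h; apply: (le_trans _ (h _)); last by rewrite lee_fin.
rewrite lee_fin mulrAC ler_pdivrMr ?exprn_gt0 ?mulr_gt0//.
rewrite -mulrA [leRHS]mulrCA ler_pM2l// natrX -exprMn.
rewrite lerXn2r ?nnegrE ?mulr_ge0 ?(ltW l2)// (ltW (lt_le_trans Ls _))//.
have : 1 <= s%:R :> R by rewrite ler1n.
by rewrite -natr1; nra.
Qed.

(** * Taylor expansion of the functions of the class *)

Lemma sum_exp_coeff_le (R : realType) (y : R) (n : nat) : 0 <= y ->
  \sum_(0 <= k < n) y ^+ k / k`!%:R <= expR y.
Proof.
move=> y0; rewrite /expR; apply: (@nondecreasing_cvgn_le _ (series (exp_coeff y))).
  apply/nondecreasing_seqP => k; rewrite /series /= big_nat_recr//= lerDl.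
  exact: exp_coeff_ge0.
exact: is_cvg_series_exp_coeff.
Qed.

(* The exponential series of [s * y] has nonnegative terms, and from rank [n] on
   they are at most [s ^+ n] times those of the series of [y]. *)
Lemma expR_taylor_le (R : realType) (s y : R) (n : nat) :
    0 <= s <= 1 -> 0 <= y ->
  expR (s * y) <= \sum_(0 <= k < n) (s * y) ^+ k / k`!%:R + s ^+ n * expR y.
Proof.
move=> /andP[s0 s1] y0; rewrite {1}/expR.
apply: limr_le; first exact: is_cvg_series_exp_coeff.
exists n => // m /= nm.
rewrite /series /= (big_cat_nat (n := n))//= lerD2l.
apply: (@le_trans _ _ (\sum_(n <= k < m) s ^+ n * (y ^+ k / k`!%:R))).
  rewrite big_seq [leRHS]big_seq; apply: ler_sum => k; rewrite mem_index_iota.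
  move=> /andP[nk _]; rewrite /exp_coeff /= exprMn -mulrA ler_wpM2r//.
    by rewrite divr_ge0 ?exprn_ge0.
  by rewrite -(subnK nk) exprD ler_piMl ?exprn_ge0 ?exprn_ile1.
rewrite -mulr_sumr ler_wpM2l ?exprn_ge0//.
apply: le_trans (sum_exp_coeff_le _ _ m y0).
rewrite [leRHS](big_cat_nat (n := n))//= lerDr.
by apply: sumr_ge0 => k _; rewrite divr_ge0 ?exprn_ge0.
Qed.

Lemma M_infty_bounds (R : realType) (f : R -> R) (t : R) :
  M_infty f -> 0 <= f t <= 1.
Proof.
move=> [f0 [mu [mu0 mu1 muf]]]; have [t0|t0] := ltP t 0; first by rewrite f0 ?lexx ?ler01.
have mI : measurable (`[0%R, +oo[%classic : set (measurableTypeR R)).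
  exact: measurable_itv.
rewrite -!lee_fin muf//; apply/andP; split.
  by apply: integral_ge0 => x _; rewrite lee_fin expR_ge0.
apply: (@le_trans _ _ (\int[mu]_(x in `[0%R, +oo[) 1)%E).
  apply: ge0_le_integral => //.
  - apply: measurable_funTS; apply/measurable_EFinP.
    by apply: measurableT_comp => //; apply: measurableT_comp.
  move=> x; rewrite /= in_itv/= andbT => x0.
  by rewrite lee_fin expR_le1 oppr_le0 mulr_ge0.
rewrite integral_cst// mul1e; apply: le_trans mu1.
by rewrite le_measure ?inE.
Qed.

(* Expanding at the right end [b] of an interval makes all the Taylor
   coefficients nonnegative; [c k] is the mass that the Poisson weights
   [expR (- y) * y ^+ k / k`!], with [y = b * x], give to [mu]. *)
Lemma M_infty_taylor (R : realType) (f : R -> R) (b : R) : M_infty f -> 0 < b ->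
  exists c : nat -> R, (forall k, 0 <= c k <= 1) /\
    forall (n : nat) (s : R), 0 <= s <= 1 ->
      \sum_(0 <= k < n) c k * s ^+ k <= f (b * (1 - s)) <=
        \sum_(0 <= k < n) c k * s ^+ k + s ^+ n.
Proof.
move=> [f0 [mu [mu0 mu1 muf]]] b0.
have mI : measurable (`[0%R, +oo[%classic : set (measurableTypeR R)).
  exact: measurable_itv.
pose phi k x : R := expR (- (b * x)) * ((b * x) ^+ k / k`!%:R).
have mphi k : measurable_fun (setT : set R) (phi k).
  apply: measurable_funM.
    by apply: measurableT_comp => //; apply: measurableT_comp.
  apply: measurable_funM => //.
  by apply: measurable_funX; apply: measurable_funM.
have mphiI k : measurable_fun (`[0%R, +oo[%classic : set R) (phi k).
  exact: measurable_funTS.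
have mphiE k : measurable_fun (`[0%R, +oo[%classic : set R) (EFin \o phi k).
  by apply/measurable_EFinP; apply: measurable_funTS.
have phi0 k x : 0 <= x -> 0 <= phi k x.
  by move=> x0; rewrite mulr_ge0 ?expR_ge0 ?divr_ge0 ?exprn_ge0 ?mulr_ge0 ?(ltW b0).
have sum_phi n s x : 0 <= x -> \sum_(0 <= k < n) s ^+ k * phi k x =
    expR (- (b * x)) * \sum_(0 <= k < n) (s * (b * x)) ^+ k / k`!%:R.
  move=> x0; rewrite mulr_sumr; apply: eq_bigr => k _.
  by rewrite /phi [(s * _) ^+ k]exprMn; ring.
(* A Poisson weight is at most 1, because [y ^+ k / k!] is a single term of the series of
   [expR y]. *)
have phi1 k x : 0 <= x -> phi k x <= 1.
  move=> x0; rewrite /phi -[leRHS](expRxMexpNx_1 (b * x)) [leRHS]mulrC ler_wpM2l ?expR_ge0//.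
  have y0 : 0 <= b * x by rewrite mulr_ge0// ltW.
  apply: le_trans (sum_exp_coeff_le _ _ k.+1 y0).
  rewrite big_nat_recr//= lerDr.
  by apply: sumr_ge0 => i _; rewrite divr_ge0 ?exprn_ge0.
pose J k := (\int[mu]_(x in `[0%R, +oo[) (phi k x)%:E)%E.
have J0 k : (0 <= J k)%E.
  by apply: integral_ge0 => x; rewrite /= in_itv/= andbT lee_fin; exact: phi0.
have muI : (mu `[0%R, +oo[%classic <= 1)%E.
  by apply: le_trans mu1; rewrite le_measure ?inE.
have J1 k : (J k <= 1)%E.
  apply: (@le_trans _ _ (\int[mu]_(x in `[0%R, +oo[) 1)%E); last first.
    by rewrite integral_cst// mul1e.
  apply: ge0_le_integral => //.
  - by move=> x; rewrite /= in_itv/= andbT lee_fin; exact: phi0.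
  - exact: mphiE.
  by move=> x; rewrite /= in_itv/= andbT lee_fin; exact: phi1.
have Jfin k : J k = (fine (J k))%:E.
  by rewrite fineK// ge0_fin_numE// (le_lt_trans (J1 k)) ?ltry.
exists (fun k => fine (J k)); split=> [k|n s /andP[s0 s1]].
  by rewrite -!lee_fin -Jfin J0 J1.
have bs0 : 0 <= b * (1 - s) by rewrite mulr_ge0 ?subr_ge0// ltW.
have JE : (\sum_(0 <= k < n) fine (J k) * s ^+ k)%:E =
    (\int[mu]_(x in `[0%R, +oo[) (\sum_(0 <= k < n) s ^+ k * phi k x)%:E)%E.
  under eq_integral do rewrite -sumEFin.
  rewrite ge0_integral_sum//.
  - rewrite -sumEFin; apply: eq_bigr => k _.
    rewrite mulrC EFinM -Jfin -ge0_integralZl_EFin ?exprn_ge0//.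
      by move=> x; rewrite /= in_itv/= andbT lee_fin; exact: phi0.
    exact: mphiE.
  - move=> k; apply/measurable_EFinP; apply: measurable_funM => //.
    exact: mphiI.
  - move=> k x; rewrite /= in_itv/= andbT => x0.
    by rewrite lee_fin mulr_ge0 ?exprn_ge0 ?phi0.
have msum : measurable_fun (`[0%R, +oo[%classic : set R)
    (fun x => (\sum_(0 <= k < n) s ^+ k * phi k x)%:E).
  apply/measurable_EFinP; apply: measurable_sum => k.
  by apply: measurable_funM => //; exact: mphiI.
have mexp t : measurable_fun (`[0%R, +oo[%classic : set R)
    (fun x => (expR (- (t * x)))%:E).
  apply: measurable_funTS; apply/measurable_EFinP.
  by apply: measurableT_comp => //; apply: measurableT_comp.
have expE x : expR (- (b * (1 - s) * x)) = expR (- (b * x)) * expR (s * (b * x)).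
  by rewrite -expRD; congr expR; ring.
have sum0 x : 0 <= x -> 0 <= \sum_(0 <= k < n) s ^+ k * phi k x.
  by move=> x0; apply: sumr_ge0 => k _; rewrite mulr_ge0 ?exprn_ge0 ?phi0.
rewrite -!lee_fin EFinD JE muf//; apply/andP; split.
  apply: ge0_le_integral => //.
  - by move=> x; rewrite /= in_itv/= andbT lee_fin; exact: sum0.
  - exact: mexp.
  move=> x; rewrite /= in_itv/= andbT lee_fin => x0; rewrite sum_phi// expE.
  rewrite ler_wpM2l ?expR_ge0// sum_exp_coeff_le// !mulr_ge0//; exact: ltW.
(* The factor [expR (- (b * x))] turns the remainder [s ^+ n * expR (b * x)] into the constant
   [s ^+ n], whose integral is at most itself. *)
apply: (@le_trans _ _ (\int[mu]_(x in `[0%R, +oo[)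
    ((\sum_(0 <= k < n) s ^+ k * phi k x)%:E + (s ^+ n)%:E))%E).
  apply: ge0_le_integral => //.
  - exact: mexp.
  - exact: emeasurable_funD.
  move=> x; rewrite /= in_itv/= andbT => x0; rewrite -EFinD lee_fin.
  have y0 : 0 <= b * x by rewrite mulr_ge0// ltW.
  have s01 : 0 <= s <= 1 by rewrite s0.
  rewrite sum_phi// expE.
  apply: (le_trans (ler_wpM2l (expR_ge0 _) (expR_taylor_le _ _ _ n s01 y0))).
  by rewrite mulrDr lerD2l mulrCA [expR (- _) * _]mulrC expRxMexpNx_1 mulr1.
rewrite ge0_integralD//.
- rewrite leeD2l// integral_cst// -[leRHS]mule1 lee_wpmul2l//.
  by rewrite lee_fin exprn_ge0.
- by move=> x; rewrite /= in_itv/= andbT lee_fin; exact: sum0.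
- by move=> x _; rewrite lee_fin exprn_ge0.
Qed.

(** * Halving intervals and piecewise functions *)

Definition halving_itv {R : realType} (b : R) (j : nat) : set R :=
  `]b / 2 ^+ j.+1, b / 2 ^+ j]%classic.

Lemma halving_itv_inj (R : realType) (b t : R) (i j : nat) : 0 < b ->
  halving_itv b i t -> halving_itv b j t -> i = j.
Proof.
move=> b0; wlog ij : i j / (i <= j)%N => [wl ti tj|].
  by have [h|h] := leqP i j; [|apply/esym]; apply: wl => //; exact: ltnW.
rewrite /halving_itv /= !in_itv/= => /andP[ti _] /andP[_ tj].
apply/eqP; rewrite eqn_leq ij leqNgt; apply/negP => ltij.
have := lt_le_trans ti tj; rewrite ltr_pM2l// ltf_pV2 ?posrE ?exprn_gt0//.
by rewrite ltr_eXn2l ?ltr1n// ltnS leqNgt ltij.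
Qed.

Lemma halving_itv_cover (R : realType) (b t : R) (m : nat) :
    b / 2 ^+ m < t <= b ->
  exists2 j : 'I_m, True & halving_itv b j t.
Proof.
elim: m => [|m IHm]; first by rewrite expr0 divr1 => /andP[/lt_le_trans h /h]; rewrite ltxx.
move=> /andP[bt tb]; have [tm|tm] := leP t (b / 2 ^+ m).
  by exists ord_max => //; rewrite /halving_itv /= in_itv /= bt.
have [|j _ tj] := IHm; first by rewrite tm tb.
by exists (widen_ord (leqnSn m) j).
Qed.

(** Gluing by indicators makes measurability that of a finite sum; the intervals being disjoint, at
    most one term is nonzero, and the value is 0 off their union. *)
Definition dyadic_sum {R : realType} (b : R) {m : nat} (F : 'I_m -> R -> R) (t : R) : R :=
  \sum_(j < m) \1_(halving_itv b j) t * F j t.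

Lemma dyadic_sumE (R : realType) (b t : R) (m : nat) (j : 'I_m)
    (F : 'I_m -> R -> R) : 0 < b -> halving_itv b j t ->
  dyadic_sum b F t = F j t.
Proof.
move=> b0 tj; rewrite /dyadic_sum (bigD1 j)//= indicE mem_set// mul1r.
rewrite big1 ?addr0// => i ij; rewrite indicE memNset ?mul0r// => ti.
by move/eqP: ij; apply; apply/val_inj; apply: halving_itv_inj ti tj.
Qed.

Lemma dyadic_sum0 (R : realType) (b t : R) (m : nat) (F : 'I_m -> R -> R) :
  (forall j : 'I_m, ~ halving_itv b j t) -> dyadic_sum b F t = 0.
Proof.
by move=> tj; apply: big1 => i _; rewrite indicE memNset ?mul0r.
Qed.

Lemma measurable_dyadic_sum (R : realType) (b : R) (m : nat) (F : 'I_m -> R -> R) :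
    (forall j, measurable_fun setT (F j)) ->
  measurable_fun setT (dyadic_sum b F : measurableTypeR R -> R).
Proof.
move=> mF; apply: measurable_sum => j; apply: measurable_funM; last exact: mF.
by apply: measurable_indic; exact: measurable_itv.
Qed.

(** * Construction of the brackets *)

Lemma bounded_Lp_space (d : measure_display) (T : measurableType d) (R : realType)
    (nu : {measure set T -> \bar R}) (p M : R) (f : T -> R) :
    (nu setT < +oo)%E -> 0 < p -> measurable_fun setT f ->
    (forall t, `|f t| <= M) ->
  Lp_space nu p f.
Proof.
move=> nuT p0 mf fM; rewrite /Lp_space /= inE; apply/andP; split; rewrite inE//.
rewrite /= /finite_norm; apply: (@le_lt_trans _ _ ('N[nu]_p%:E [EFin \o (cst M)])%E).
  apply: le_Lnorm => // t; rewrite (le_trans (fM t))//= ler_norm//.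
rewrite unlock /Lnorm poweR_lty//.
under eq_integral => x _ do rewrite /= -[_%:E]/(cst (`|M| `^ p)%:E x).
by rewrite integral_cst// lte_mul_pinfty// lee_fin powR_ge0.
Qed.

(** The expansion is centred at the right end of the [j]-th interval; there the local variable lies
    between 0 and 1/2. *)
Definition taylor_poly {R : realType} (b : R) {m n : nat} (q : 'I_m -> 'I_n -> R)
    (j : 'I_m) (t : R) : R :=
  \sum_(k < n) q j k * (1 - t / (b / 2 ^+ j)) ^+ k.

(** The value is [w] on the halving intervals and 1 elsewhere, where the bracket is [0, 1]. *)
Definition bracket_width {R : realType} (b w : R) (m : nat) (t : R) : R :=
  1 + dyadic_sum b (fun (_ : 'I_m) _ => w - 1) t.

Lemma bracket_width_le (R : realType) (b w t : R) (m : nat) : 0 < b ->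
  0 <= w <= 1 -> 0 <= bracket_width b w m t <= 1.
Proof.
move=> b0 /andP[w0 w1]; rewrite /bracket_width.
have [[j tj]|nt] := pselect (exists j : 'I_m, halving_itv b j t).
  by rewrite (dyadic_sumE _ _ _ _ j)//; lra.
by rewrite dyadic_sum0 => [|j tj]; [lra|apply: nt; exists j].
Qed.

Lemma measurable_taylor_poly (R : realType) (b : R) (m n : nat)
    (q : 'I_m -> 'I_n -> R) (j : 'I_m) : measurable_fun setT (taylor_poly b q j).
Proof.
apply: measurable_sum => k; apply: measurable_funM => //; apply: measurable_funX.
by apply: measurable_funB => //; apply: measurable_funM.
Qed.

Lemma halving_itv_local (R : realType) (b t : R) (j : nat) : 0 < b ->
  halving_itv b j t -> 0 <= 1 - t / (b / 2 ^+ j) <= 2^-1.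
Proof.
move=> b0; rewrite /halving_itv /= in_itv/= => /andP[tl tu].
have bj0 : 0 < b / 2 ^+ j by rewrite divr_gt0 ?exprn_gt0.
have tl' : (b / 2 ^+ j) / 2 < t by move: tl; rewrite exprS invfM mulrCA mulrC.
rewrite subr_ge0 ler_pdivrMr// mul1r tu /=.
by rewrite lerBlDr -lerBlDl ler_pdivlMr//; lra.
Qed.

(** A crude bound, whose purpose is to put the ends of the brackets in L^p. *)
Lemma dyadic_taylor_bound (R : realType) (b t : R) (m n : nat)
    (q : 'I_m -> 'I_n -> R) : 0 < b -> (forall j k, 0 <= q j k <= 1) ->
  0 <= dyadic_sum b (taylor_poly b q) t <= n%:R.
Proof.
move=> b0 q01.
have [[j tj]|nt] := pselect (exists j : 'I_m, halving_itv b j t); last first.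
  by rewrite dyadic_sum0 => [|j tj]; [rewrite lexx ler0n|apply: nt; exists j].
rewrite (dyadic_sumE _ _ _ _ j)//.
have /andP[s0 s1] := halving_itv_local _ _ _ _ b0 tj.
rewrite /taylor_poly; set s := 1 - _ in s0 s1 *; apply/andP; split.
  apply: sumr_ge0 => k _; have /andP[q0 _] := q01 j k.
  by rewrite mulr_ge0 ?exprn_ge0.
rewrite -[n in leRHS]card_ord -sum1_card natr_sum; apply: ler_sum => k _.
have /andP[q0 q1] := q01 j k.
by rewrite mulr_ile1 ?exprn_ge0 ?exprn_ile1//; lra.
Qed.

(** The p-th power of the norm is at most the mass of the complement of [A] plus [(eps / 2) ^ p],
    hence at most [(4 ^ (- p) + 2 ^ (- p)) * eps ^ p]; for [p >= 1] the sum in front is at most 1/4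
    + 1/2. *)
Lemma bracket_width_dist (d : measure_display) (T : measurableType d) (R : realType)
    (nu : {measure set T -> \bar R}) (p eps : R) (A : set T) (h : T -> R) :
    nu setT = 1%E -> 1 <= p -> 0 < eps -> measurable A ->
    (nu A >= (1 - 4 `^ (- p) * eps `^ p)%:E)%E ->
    measurable_fun setT h -> (forall t, `|h t| <= 1) ->
    (forall t, A t -> `|h t| <= eps / 2) ->
  ('N[nu]_p%:E [EFin \o h] <= eps%:E)%E.
Proof.
move=> nuT p1 eps0 mA nuA mh h1 hA.
have p0 : 0 < p by lra.
have epsp : (eps%:E = (eps `^ p)%:E `^ p^-1)%E.
  by rewrite poweR_EFin -powRrM divff ?gt_eqF// powRr1// ltW.
rewrite unlock /Lnorm epsp; apply: le_poweR; rewrite ?invr_ge0 ?(ltW p0)//.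
  by apply: integral_ge0 => x _; exact: poweR_ge0.
apply: (@le_trans _ _ (\int[nu]_t ((\1_(~` A) t)%:E + ((eps / 2) `^ p)%:E))%E).
  apply: ge0_le_integral => //.
  - by move=> t _; exact: poweR_ge0.
  - apply: (measurableT_comp (measurable_poweR _)).
    by apply: measurableT_comp => //; exact/measurable_EFinP.
  - apply: emeasurable_funD => //; apply/measurable_EFinP.
    by apply: measurable_indic; exact: measurableC.
  move=> t _; rewrite /= lee_fin indicE.
  have [tA|tA] := pselect (A t).
    rewrite memNset ?add0r; last by apply.
    by rewrite ge0_ler_powR ?nnegrE ?hA ?divr_ge0 ?(ltW p0) ?(ltW eps0).
  rewrite mem_set//; apply: (@le_trans _ _ 1); last by rewrite lerDl powR_ge0.
  apply: (@le_trans _ _ (1 `^ p)); last by rewrite powR1.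
  by rewrite ge0_ler_powR ?nnegrE ?(ltW p0).
rewrite ge0_integralD//; last 2 first.
- apply/measurable_EFinP.
  by apply: measurable_indic; exact: measurableC.
- by move=> t _; rewrite lee_fin powR_ge0.
rewrite integral_indic ?setIT//; last exact: measurableC.
rewrite integral_cst// nuT mule1.
have nuAC : (nu (~` A) <= (4 `^ (- p) * eps `^ p)%:E)%E.
  have nuE : (nu A + nu (~` A) = 1)%E.
    rewrite -nuT -(setUCr A) measureU//; [exact: measurableC|exact: setICr].
  have nuA1 : (nu A <= 1)%E by rewrite -nuT le_measure ?inE.
  have nuC1 : (nu (~` A) <= 1)%E by rewrite -nuT le_measure ?inE//; exact: measurableC.
  have Afin : nu A = (fine (nu A))%:E.
    by rewrite fineK// ge0_fin_numE// (le_lt_trans nuA1) ?ltry.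
  have Cfin : nu (~` A) = (fine (nu (~` A)))%:E.
    by rewrite fineK// ge0_fin_numE// (le_lt_trans nuC1) ?ltry.
  move: nuE nuA; rewrite Afin Cfin -EFinD !lee_fin => -[]; lra.
apply: (le_trans (leeD nuAC (lexx _))); rewrite -EFinD lee_fin.
rewrite powRM ?invr_ge0 ?(ltW eps0)// [eps `^ p * _]mulrC -mulrDl.
rewrite ler_piMl ?powR_ge0//.
have Vle (x : R) : 0 < x -> x <= 1 -> x `^ p <= x.
  move=> x0 x1; rewrite -[leRHS]powRr1 ?(ltW x0)//.
  by rewrite ger_powR// x0.
have -> : 4 `^ (- p) = 4^-1 `^ p :> R by rewrite -mulN1r powRrM powR_inv1.
have := Vle 4^-1; have := Vle 2^-1; lra.
Qed.

Lemma sum_expr_half_le (R : realFieldType) (s : R) (n : nat) : 0 <= s <= 2^-1 ->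
  \sum_(k < n) s ^+ k <= 2.
Proof.
move=> /andP[s0 s1]; suff : \sum_(k < n) s ^+ k <= 2 - 2 * 2^-1 ^+ n.
  by move/le_trans; apply; rewrite lerBlDr lerDl mulr_ge0 ?exprn_ge0.
elim: n => [|n IHn]; first by rewrite big_ord0 expr0; lra.
have : s ^+ n <= 2^-1 ^+ n by rewrite lerXn2r ?nnegrE.
rewrite big_ord_recr /= exprS; move: (s ^+ n) (2^-1 ^+ n) IHn => x y; lra.
Qed.

(** Rounding down [N * c]; the case [c = 1] reaches the index [N], whence [N + 1] levels. *)
Lemma quantization (R : realType) (N : nat) (c : R) : (0 < N)%N -> 0 <= c <= 1 ->
  exists q : 'I_N.+1, q%:R / N%:R <= c <= q%:R / N%:R + N%:R^-1.
Proof.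
move=> N0 /andP[c0 c1]; have NR : 0 < N%:R :> R by rewrite ltr0n.
have Nc0 : 0 <= N%:R * c by rewrite mulr_ge0.
have /andP[] := truncn_itv Nc0; set q := Num.truncn _ => qc cq.
have qN : (q < N.+1)%N.
  by rewrite ltnS -(ler_nat R) (le_trans qc)// ler_piMr.
exists (Ordinal qN) => /=; rewrite -[X in _ + X]mul1r -mulrDl.
by rewrite ler_pdivrMr// ler_pdivlMr// natr1 mulrC qc ltW.
Qed.

Definition bracket_index (m n N : nat) : finType := {ffun 'I_m * 'I_n -> 'I_N.+1}.

Definition lower_end {R : realType} (b : R) {m n N : nat}
    (phi : bracket_index m n N) : R -> R :=
  dyadic_sum b (taylor_poly b (fun j k => (phi (j, k))%:R / N%:R)).

Definition upper_end {R : realType} (b w : R) {m n N : nat}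
    (phi : bracket_index m n N) (t : R) : R :=
  lower_end b phi t + bracket_width b w m t.

Lemma lower_end_bound (R : realType) (b t : R) (m n N : nat)
    (phi : bracket_index m n N) : 0 < b -> (0 < N)%N ->
  0 <= lower_end b phi t <= n%:R.
Proof.
move=> b0 N0.
apply: dyadic_taylor_bound => // j k.
have NR : 0 < N%:R :> R by rewrite ltr0n.
rewrite divr_ge0//= ler_pdivrMr// mul1r ler_nat -ltnS; exact: ltn_ord.
Qed.

(** On a halving interval, rounding costs [1 / N] per coefficient, hence at most [2 / N] after
    summing the powers of [s <= 1/2], and truncation costs [2 ^ (- n)]. Off the intervals the
    bracket [0, 1] suffices. *)
Lemma M_infty_in_bracket (R : realType) (b w : R) (m n N : nat) (f : R -> R) :
    0 < b -> (0 < N)%N -> 2 / N%:R + 2^-1 ^+ n <= w -> M_infty f ->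
  exists phi : bracket_index m n N,
    forall t, lower_end b phi t <= f t <= upper_end b w phi t.
Proof.
move=> b0 N0 wE Mf; have NR : 0 < N%:R :> R by rewrite ltr0n.
have /choice[c cP] (j : 'I_m) : exists c : nat -> R, (forall k, 0 <= c k <= 1) /\
    forall (n : nat) (s : R), 0 <= s <= 1 ->
      \sum_(0 <= k < n) c k * s ^+ k <= f ((b / 2 ^+ j) * (1 - s)) <=
        \sum_(0 <= k < n) c k * s ^+ k + s ^+ n.
  by apply: M_infty_taylor => //; rewrite divr_gt0 ?exprn_gt0.
have /choice[phi phiP] (jk : 'I_m * 'I_n) : exists q : 'I_N.+1,
    q%:R / N%:R <= c jk.1 jk.2 <= q%:R / N%:R + N%:R^-1.
  by apply: quantization => //; apply: (cP jk.1).1.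
exists [ffun jk => phi jk] => t; rewrite /upper_end /lower_end.
have [[j tj]|nt] := pselect (exists j : 'I_m, halving_itv b j t); last first.
  have ntj (j : 'I_m) : ~ halving_itv b j t by move=> tj; apply: nt; exists j.
  by rewrite /bracket_width !dyadic_sum0// add0r addr0 M_infty_bounds.
rewrite /bracket_width !(dyadic_sumE _ _ _ _ j)//.
have s01 := halving_itv_local _ _ _ _ b0 tj.
have [_ /(_ n (1 - t / (b / 2 ^+ j)))] := cP j.
have bj0 : b / 2 ^+ j != 0 by rewrite gt_eqF ?divr_gt0 ?exprn_gt0.
rewrite subKr [_ * (t / _)]mulrC divfK//.
rewrite /taylor_poly; move: (1 - t / _) s01 => s /andP[s0 s1].
have -> : 0 <= s <= 1 by rewrite s0 /= (le_trans s1)//; lra.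
move=> /(_ isT)/andP[lf fu]; rewrite !big_mkord in lf fu.
apply/andP; split.
  apply: le_trans lf; apply: ler_sum => k _; rewrite ffunE ler_wpM2r ?exprn_ge0//.
  by have /andP[] := phiP (j, k).
apply: (le_trans fu).
have : \sum_(k < n) c j k * s ^+ k <=
    \sum_(k < n) (([ffun jk => phi jk] (j, k))%:R / N%:R) * s ^+ k +
    N%:R^-1 * \sum_(k < n) s ^+ k.
  rewrite mulr_sumr -big_split /=; apply: ler_sum => k _.
  rewrite ffunE -mulrDl ler_wpM2r ?exprn_ge0//.
  by have /andP[] := phiP (j, k).
have : N%:R^-1 * \sum_(k < n) s ^+ k <= 2 / N%:R.
  rewrite mulrC ler_wpM2r ?invr_ge0// sum_expr_half_le//; exact/andP.
have : s ^+ n <= 2^-1 ^+ n by rewrite lerXn2r ?nnegrE.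
move: wE; lra.
Qed.

(** As [Gamma / 2 ^+ m < gamma], the [m] halving intervals below [Gamma] cover [gamma, Gamma]. There
    the width is [eps / 2], as [bracket_width_dist] requires. *)
Lemma Lp_bracketing_number_le (R : realType)
    (nu : {measure set (measurableTypeR R) -> \bar R}) (p eps gamma Gamma : R)
    (m n N : nat) : nu setT = 1%E -> 1 <= p -> 0 < eps <= 1 -> 0 < Gamma ->
    Gamma / 2 ^+ m < gamma -> (0 < N)%N -> 2 / N%:R + 2^-1 ^+ n <= eps / 2 ->
    (nu `[gamma, Gamma]%classic >= (1 - 4 `^ (- p) * eps `^ p)%:E)%E ->
  (Lp_bracketing_number nu p eps (@M_infty R) <= (N.+1 ^ (m * n))%:R%:E)%E.
Proof.
move=> nuT p1 /andP[eps0 eps1] Gamma0 Gm N0 wE nuG.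
have p0 : 0 < p by lra.
pose w := eps / 2; have w01 : 0 <= w <= 1 by rewrite /w; lra.
have -> : (N.+1 ^ (m * n))%N = #|bracket_index m n N|.
  by rewrite card_ffun card_prod !card_ord.
pose l k := lower_end Gamma (@enum_val (bracket_index m n N) predT k).
pose u k := upper_end Gamma w (@enum_val (bracket_index m n N) predT k).
have ml k : measurable_fun setT (l k : measurableTypeR R -> R).
  by apply: measurable_dyadic_sum => j; exact: measurable_taylor_poly.
have mw : measurable_fun setT (bracket_width Gamma w m : measurableTypeR R -> R).
  by apply: measurable_funD => //; exact: measurable_dyadic_sum.
have mu k : measurable_fun setT (u k : measurableTypeR R -> R).
  by apply: measurable_funD => //; exact: ml.
have lb k t : 0 <= l k t <= n%:R by apply: lower_end_bound.
have wb t : 0 <= bracket_width Gamma w m t <= 1 by apply: bracket_width_le.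
have nuTy : (nu setT < +oo)%E by rewrite nuT ltry.
apply: ge_ereal_inf; exists (#|bracket_index m n N|%:R%:E) => //.
exists #|bracket_index m n N| => //; exists l, u; split=> [k|f Mf].
  split.
  - apply: (@bounded_Lp_space _ _ _ _ _ n%:R) => // t.
    by have /andP[l0 ?] := lb k t; rewrite ger0_norm.
  - apply: (@bounded_Lp_space _ _ _ _ _ (n%:R + 1)) => // t.
    have /andP[l0 l1] := lb k t; have /andP[w0 w1] := wb t.
    by rewrite ger0_norm; [exact: lerD|exact: addr_ge0].
  rewrite /Lp_dist (_ : u k \- l k = bracket_width Gamma w m); last first.
    by apply/funext => t; rewrite /u /upper_end /= addrC addKr.
  have mI : measurable (`[gamma, Gamma]%classic : set (measurableTypeR R)).
    exact: measurable_itv.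
  have := @bracket_width_dist _ _ _ nu _ _ _ _ nuT p1 eps0 mI nuG mw.
  apply.
  - by move=> t; have /andP[w0 w1] := wb t; rewrite ger0_norm.
  move=> t; rewrite /= in_itv/= => /andP[gt tG].
  have [|j _ tj] := @halving_itv_cover _ Gamma t m.
    by rewrite tG andbT (lt_le_trans Gm).
  rewrite /bracket_width (dyadic_sumE _ _ _ _ j)// addrC subrK ger0_norm//.
  by case/andP: w01.
have [phi phiP] := M_infty_in_bracket _ _ _ m _ _ _ Gamma0 N0 wE Mf.
exists (enum_rank phi) => //; split => // t.
by rewrite /l /u enum_rankK; exact: phiP.
Qed.

(** * Upper bound for the bracketing entropy *)

Lemma ln2_ge (R : realType) : 2^-1 <= ln 2 :> R.
Proof.
rewrite -[ln 2]opprK -lnV ?posrE// lerNr (_ : 2^-1 = 1 + - 2^-1); last by field.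
by apply: le_trans (le_ln1Dx _) _; lra.
Qed.

Lemma normr_ln_ge (R : realType) (eps : R) : 0 < eps < 4^-1 ->
  `|ln eps| = ln eps^-1 /\ 2 * ln 2 <= `|ln eps|.
Proof.
move=> /andP[eps0 eps4].
have LE : `|ln eps| = ln eps^-1 by rewrite ler0_norm ?lnV ?posrE// ln_le0//; lra.
split=> //; rewrite LE (_ : 2 * ln 2 = ln (2 ^+ 2)); last by rewrite lnXn// mulr2n; ring.
rewrite ler_ln ?posrE ?exprn_gt0 ?invr_gt0// -[2 ^+ 2]invrK.
by rewrite lef_pV2 ?posrE ?invr_gt0 ?exprn_gt0// expr2 -natrM ltW.
Qed.

Lemma lne_bracketing_number_le (R : realType)
    (nu : {measure set (measurableTypeR R) -> \bar R}) (p eps gamma Gamma : R) :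
    nu setT = 1%E -> 1 <= p -> 0 < eps < 4^-1 -> 0 < gamma -> gamma < Gamma ->
    (nu `[gamma, Gamma]%classic >= (1 - 4 `^ (- p) * eps `^ p)%:E)%E ->
  (lne (Lp_bracketing_number nu p eps (@M_infty R)) <=
    (45 * Num.max 1 (ln (Gamma / gamma)) * `|ln eps| ^+ 2)%:E)%E.
Proof.
move=> nuT p1 /andP[eps0 eps4] gamma0 gG nuG.
have Gamma0 : 0 < Gamma by apply: lt_trans gG.
have l2 := ln2_ge R.
have l20 : 0 < ln 2 :> R by lra.
have half (x : R) : 0 <= x -> x / ln 2 <= 2 * x.
  by move=> x0; rewrite ler_pdivrMr//; nra.
have [|LE L2] := normr_ln_ge _ eps; first by rewrite eps0.
have e4 : 4 < eps^-1 by rewrite -[4]invrK ltf_pV2 ?posrE ?invr_gt0.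
rewrite LE in L2 *; set L := ln eps^-1 in L2 *; set G := ln (Gamma / gamma).
have L1 : 1 <= L by lra.
have G0 : 0 <= G by rewrite ln_ge0// ler_pdivlMr// mul1r ltW.
have G20 : 0 <= G / ln 2 by rewrite divr_ge0// ltW.
have L20 : 0 <= L / ln 2 by rewrite divr_ge0//; lra.
have e80 : 0 <= 8 / eps by rewrite divr_ge0// ltW.
(* The three truncations ensure [2 ^ m > Gamma / gamma], [2 ^ n > 1 / eps] and [N > 8 / eps]. Using
   [n + 2] coefficients then makes the rounding and truncation errors at most [eps / 4] each. *)
have /andP[+ +] := truncn_itv G20; set m := (Num.truncn (G / _)).+1 => mG Gm.
have /andP[+ +] := truncn_itv L20; set n := (Num.truncn (L / _)).+1 => nL Ln.
have /andP[+ +] := truncn_itv e80; set N := (Num.truncn (8 / _)).+1 => Ne eN.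
(* The maximum with 1 absorbs the unit added by rounding up; 45 is the product of the constants 3, 5
   and 3 in [mE], [nE] and [NE]. *)
have mE : m%:R <= 3 * Num.max 1 G :> R.
  apply: (@le_trans _ _ (2 * G + 1)).
    by rewrite /m -natr1 lerD2r (le_trans mG)// half.
  have : 1 <= Num.max 1 G by rewrite le_max lexx.
  have : G <= Num.max 1 G by rewrite le_max lexx orbT.
  by lra.
have nE : n.+2%:R <= 5 * L.
  rewrite /n -addn3 natrD; have := le_trans nL (half _ (le_trans ler01 L1)); lra.
have NE : ln N.+1%:R <= 3 * L.
  rewrite [3 * L]mulr_natl -lnXn ?invr_gt0// ler_ln ?posrE ?exprn_gt0 ?invr_gt0//.
  rewrite /N -addn2 natrD; move: Ne; set x := _%:R; move: eps^-1 e4 => e e4 Ne.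
  apply: (@le_trans _ _ (16 * e)); first lra.
  by rewrite !exprS expr0; nra.
have N0 : (0 < N)%N by [].
clearbody m n N; clear mG nL Ne.
have bound : (Lp_bracketing_number nu p eps (@M_infty R) <=
    (N.+1 ^ (m * n.+2))%:R%:E)%E.
  apply: (@Lp_bracketing_number_le _ _ _ _ gamma Gamma) => //.
  - by rewrite eps0 /=; lra.
  - rewrite ltr_pdivrMr ?exprn_gt0// mulrC -ltr_pdivrMr//.
    rewrite -ltr_ln ?posrE ?divr_gt0 ?exprn_gt0// lnXn// -[ltRHS]mulr_natl.
    by rewrite -ltr_pdivrMr.
  have N4 : 2 / N%:R <= eps / 4.
    rewrite ler_pdivrMr ?ltr0n// mulrAC ler_pdivlMr//.
    by move: eN; rewrite ltr_pdivrMr// => /ltW; lra.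
  have n4 : 2^-1 ^+ n.+2 <= eps / 4.
    have h : 2^-1 ^+ n <= eps.
      rewrite exprVn -[eps]invrK lef_pV2 ?posrE ?exprn_gt0 ?invr_gt0//.
      rewrite -ler_ln ?posrE ?invr_gt0 ?exprn_gt0// lnXn// -[leRHS]mulr_natl.
      by rewrite -ler_pdivrMr// ltW.
    by rewrite exprS exprS mulrA; move: (_ ^+ n) h => y h; lra.
  by lra.
apply: (le_trans (le_lne _ _ _ _ bound)).
  by apply: le_ereal_inf_tmp => _ [k _ <-]; rewrite lee_fin.
rewrite lne_natX// lee_fin natrM.
have lnN0 : 0 <= ln N.+1%:R :> R by rewrite ln_ge0// ler1n.
rewrite (_ : 45 * _ * _ = 3 * Num.max 1 G * (5 * L) * (3 * L)); last by ring.
by rewrite !ler_pM// mulr_ge0.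
Qed.

(** * From brackets to balls *)

(** A bracket of width at most [eps] lies within [eps / 2] of its midpoint, hence in the open ball
    of radius [eps]: passing to balls loses nothing. *)
Lemma covering_le_bracketing (d : measure_display) (T : measurableType d)
    (R : realType) (nu : {measure set T -> \bar R}) (p eps : R)
    (F : set (T -> R)) : 1 <= p -> 0 < eps ->
    (forall f, F f -> measurable_fun setT f) ->
  (Lp_covering_number nu p eps F <= Lp_bracketing_number nu p eps F)%E.
Proof.
move=> p1 eps0 mF; apply: ereal_inf_le_tmp => _ [n [l [u [luE Flu]]] <-].
have p1E : (1 <= p%:E)%E by rewrite lee_fin.
have [zeroE lin] := Lfun_submod_closed nu p1E.
pose h k : T -> R := (-1) *: l k + u k.
have hE k : h k \in Lfun nu p%:E by have [lE uE _] := luE k; exact: lin.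
(* The midpoint is written as [l + (u - l) / 2], so that it stays in L^p by linearity. *)
exists n => //; exists (fun k => 2^-1 *: h k + l k); split=> [k|f Ff].
  by have [lE _ _] := luE k; apply: lin.
have [k _ [_ flu]] := Flu f Ff; exists k => //=.
have [lE uE dist] := luE k.
have mh g : g \in Lfun nu p%:E -> measurable_fun setT g.
  by case/andP; rewrite inE.
apply: (@le_lt_trans _ _ ('N[nu]_p%:E [EFin \o (2^-1 \*: h k)])%E).
  apply: le_Lnorm; rewrite ?(lt_le_trans _ p1)//.
  - apply: measurable_funB; first exact: mF.
    by apply: (mh (2^-1 *: h k + l k)); apply: lin.
  - by apply: (mh (2^-1 *: h k)); rewrite -[_ *: _]addr0; exact: lin.
  move=> t; have /andP[lf fu] := flu t; rewrite /h /= !fctE /GRing.scale /=.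
  have lu := le_trans lf fu.
  rewrite [leRHS]ger0_norm; last by lra.
  by rewrite ler_norml; lra.
have := LnormZ (Lfun_Sub p1E (hE k)) 2^-1; rewrite Lfun_valP => ->.
rewrite ger0_norm//; apply: (@le_lt_trans _ _ (2^-1%:E * eps%:E)%E).
  rewrite lee_wpmul2l//; apply: le_trans dist; rewrite le_eqVlt; apply/orP; left.
  apply/eqP/eq_Lnorm => t.
  by rewrite /h /= !fctE /GRing.scale /= mulN1r addrC.
by rewrite -EFinM lte_fin; lra.
Qed.

(** * Lebesgue measure on [0, 1] and conclusion *)

Lemma lebesgue01_setT (R : realType) : lebesgue01 R setT = 1%E.
Proof.
rewrite /lebesgue01 /= /mrestr setTI lebesgue_measure_itv /=.
by rewrite lte_fin ltr01 oppr0 adde0.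
Qed.

Lemma lebesgue01_itv1 (R : realType) (a : R) : 0 < a < 1 ->
  lebesgue01 R `[a, 1]%classic = (1 - a)%:E.
Proof.
move=> /andP[a0 a1]; rewrite /lebesgue01 /= /mrestr setIidl.
  by rewrite lebesgue_measure_itv /= lte_fin a1.
by move=> t /=; rewrite !in_itv/= => /andP[at1 ->]; rewrite (le_trans (ltW a0)).
Qed.

(** For [p = 2], the interval from [eps ^+ 2 / 16] to 1 has exactly the required mass. Its
    logarithmic length [4 * ln 2 + 2 * |ln eps|] is at most [4 * |ln eps|], and 180 is 45 times
    4. *)
Lemma lne_bracketing_number01_le (R : realType) (eps : R) : 0 < eps < 4^-1 ->
  (lne (Lp_bracketing_number (lebesgue01 R) 2 eps (@M_infty R)) <=
    (180 * `|ln eps| ^+ 3)%:E)%E.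
Proof.
move=> eps4; have /andP[eps0 epslt] := eps4.
have e16 : 4 `^ (- 2) * eps `^ 2 = eps ^+ 2 / 16 :> R.
  by rewrite powRN !powR_mulrn ?(ltW eps0)// -natrX mulrC.
have a0 : 0 < eps ^+ 2 / 16 by rewrite divr_gt0 ?exprn_gt0.
have a1 : eps ^+ 2 / 16 < 1 by rewrite expr2; nra.
have nuE : ((1 - 4 `^ (- 2) * eps `^ 2)%:E <=
    lebesgue01 R `[(eps ^+ 2 / 16)%R, 1%R]%classic)%E.
  by rewrite lebesgue01_itv1 ?a0// e16.
apply: le_trans (lne_bracketing_number_le _ _ _ _ _ _ (lebesgue01_setT R) _
  eps4 a0 a1 nuE) _; first by rewrite ler1n.
have [LE L2] := normr_ln_ge _ _ eps4; have l2 := ln2_ge R.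
have lnE : ln (1 / (eps ^+ 2 / 16)) = 4 * ln 2 + 2 * `|ln eps|.
  rewrite (_ : 1 / _ = 2 ^+ 4 * (eps^-1) ^+ 2); last by field; rewrite gt_eqF.
  rewrite lnM ?posrE ?exprn_gt0 ?invr_gt0// !lnXn ?invr_gt0// -LE.
  by rewrite -[ln 2 *+ 4]mulr_natl -[`|ln eps| *+ 2]mulr_natl.
rewrite lee_fin lnE.
have : Num.max 1 (4 * ln 2 + 2 * `|ln eps|) <= 4 * `|ln eps|.
  by rewrite ge_max; apply/andP; split; lra.
move: (Num.max _ _) => M MB.
rewrite (_ : 180 * _ = 45 * (4 * `|ln eps|) * `|ln eps| ^+ 2); last by ring.
by rewrite ler_wpM2r ?exprn_ge0// ler_pM2l.
Qed.

(** The maximum with 1 cannot be replaced by the logarithm alone: for a Dirac mass at 1,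
    [Gamma / gamma] may be arbitrarily close to 1, whereas a single bracket is never enough. *)
Theorem theorem1p1 (R : realType) :
  (forall p : R, 1 <= p ->
    exists C : R,
      forall nu : probability (measurableTypeR R) R, on_nonneg nu ->
      forall eps : R, 0 < eps < 4^-1 ->
        (forall gamma Gamma : R, 0 < gamma -> gamma < Gamma ->
          (nu `[gamma, Gamma]%classic >= (1 - 4 `^ (- p) * eps `^ p)%:E)%E ->
          (lne (Lp_bracketing_number nu p eps (@M_infty R)) <=
            (C * Num.max 1 (ln (Gamma / gamma)) * `|ln eps| ^+ 2)%:E)%E) /\
        (forall K : R, 1 < K ->
          (nu `[(eps `^ K)%R, (eps `^ (- K))%R]%classic >=
            (1 - 4 `^ (- p) * eps `^ p)%:E)%E ->
          (lne (Lp_bracketing_number nu p eps (@M_infty R)) <=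
            (C * K * `|ln eps| ^+ 3)%:E)%E)) /\
  (asymp_on `]0, 4^-1[
     (fun eps => lne (Lp_bracketing_number (lebesgue01 R) 2 eps (@M_infty R)))
     (fun eps => lne (Lp_covering_number (lebesgue01 R) 2 eps (@M_infty R))) /\
   asymp_on `]0, 4^-1[
     (fun eps => lne (Lp_covering_number (lebesgue01 R) 2 eps (@M_infty R)))
     (fun eps => (`|ln eps| ^+ 3)%:E)).
Proof.
split.
  (* The logarithm of [eps ^ (- K) / eps ^ K] is [2 * K * |ln eps|], which doubles the constant
     45. *)
  move=> p p1; exists 90 => nu _ eps eps4; have /andP[eps0 epslt] := eps4.
  have nuT : nu setT = 1%E by exact: probability_setT.
  have L0 : 0 <= `|ln eps| by [].
  split=> [gamma Gamma g0 gG nuG|K K1 nuK].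
    apply: le_trans (lne_bracketing_number_le _ _ _ _ _ _ nuT p1 eps4 g0 gG nuG) _.
    rewrite lee_fin ler_wpM2r ?exprn_ge0// ler_wpM2r ?le_max ?ler01//.
    by rewrite ler_nat.
  have [_ L2] := normr_ln_ge _ _ eps4; have l2 := ln2_ge R.
  have LE : `|ln eps| = - ln eps by rewrite ler0_norm// ln_le0//; lra.
  have ln0 : ln eps < 0 by rewrite ln_lt0// eps0/=; lra.
  have g0 : 0 < eps `^ K by rewrite powR_gt0.
  have G0 : 0 < eps `^ (- K) by rewrite powR_gt0.
  have lnG : ln (eps `^ (- K) / eps `^ K) = 2 * K * `|ln eps|.
    by rewrite ln_div ?posrE// !ln_powR LE; ring.
  have gG : eps `^ K < eps `^ (- K).
    by rewrite -ltr_ln ?posrE// !ln_powR; nra.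
  apply: le_trans (lne_bracketing_number_le _ _ _ _ _ _ nuT p1 eps4 g0 gG nuK) _.
  rewrite lee_fin lnG max_r; last by nra.
  by rewrite le_eqVlt; apply/orP; left; apply/eqP; ring.
(* Both equivalences follow from one chain: [c * |ln eps| ^ 3], covering entropy, bracketing
   entropy, [180 * |ln eps| ^ 3], in increasing order. *)
have [c c0 cP] := lne_covering_number_ge R.
have cov_br eps : 0 < eps < 4^-1 ->
    (lne (Lp_covering_number (lebesgue01 R) 2 eps (@M_infty R)) <=
     lne (Lp_bracketing_number (lebesgue01 R) 2 eps (@M_infty R)))%E.
  move=> /andP[eps0 _]; apply: le_lne.
    by apply: le_ereal_inf_tmp => _ [k _ <-]; rewrite lee_fin.
  apply: covering_le_bracketing => //; first by rewrite ler1n.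
  exact: measurable_M_infty.
split.
  exists (c / 180), 1; split; rewrite ?divr_gt0// => eps; rewrite /= in_itv /= => eps4.
  split; last by rewrite mul1e cov_br.
  apply: le_trans (cP _ eps4).
  apply: (@le_trans _ _ ((c / 180)%:E * (180 * `|ln eps| ^+ 3)%:E)%E).
    by rewrite lee_wpmul2l ?lee_fin ?divr_ge0 ?(ltW c0)// lne_bracketing_number01_le.
  by rewrite -EFinM lee_fin mulrA divfK ?pnatr_eq0.
exists (180^-1), (c^-1); split; rewrite ?invr_gt0// => eps; rewrite /= in_itv /= => eps4.
split.
  apply: (@le_trans _ _ ((180^-1)%:E * (180 * `|ln eps| ^+ 3)%:E)%E).
    rewrite lee_wpmul2l ?lee_fin ?invr_ge0//.
    exact: le_trans (cov_br _ eps4) (lne_bracketing_number01_le _ _ eps4).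
  by rewrite -EFinM lee_fin mulrA mulVf ?mul1r ?pnatr_eq0.
apply: (@le_trans _ _ ((c^-1)%:E * (c * `|ln eps| ^+ 3)%:E)%E).
  by rewrite -EFinM lee_fin mulrA mulVf ?mul1r ?gt_eqF.
by rewrite lee_wpmul2l ?lee_fin ?invr_ge0 ?(ltW c0)// cP.
Qed.
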